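(* Let $A\in M_n(\mathbb{Z})$ be an integer matrix with $\det A\neq 0$. (1) If there is a unique eigenvalue $\lambda$ of $A$ of maximal modulus, with algebraic multiplicity one, then $\lambda\in\mathbb{R}$, and there exist a simplicial toric birational model $X$ (possibly singular) and a positive integer $k$ such that $f_A^k$ is strongly algebraically stable on $X$. (2) If $\lambda,\bar\lambda$ are the only eigenvalues of $A$ of maximal modulus, also with algebraic multiplicity one, and if $\lambda=|\lambda|\cdot e^{2\pi i\theta}$ with $\theta\notin\mathbb{Q}$, then there is no toric birational model on which $f_A$ is strongly algebraically stable.
   Context: Let $N=\mathbb{Z}^n$ (column vectors), $N_{\mathbb{R}}=\mathbb{R}^n$, $M=\mathrm{Hom}(N,\mathbb{Z})$. A cone means a strongly convex rational polyhedral cone in $N_{\mathbb{R}}$; fans are finite. All toric varieties are complete and simplicial (every cone of the fan is generated by linearly independent vectors). A toric birational model is a complete simplicial toric variety $X=X(\Sigma)$ associated with a complete simplicial fan $\Sigma$ in $N_{\mathbb{R}}$. $\Sigma(1)$ is the set of rays of $\Sigma$; the ray generator of a ray is its nonzero lattice point of smallest norm; $V(\tau)$ is the torus-invariant prime divisor (orbit closure) of a ray $\tau$. A matrix $A\in M_n(\mathbb{Z})$ with nonzero determinant acts on $N$ by left multiplication and induces a dominant toric rational map $f_A:X(\Sigma)\dashrightarrow X(\Sigma)$, which on the torus is the monomial map $f_A(x_1,\dots,x_n)=(\prod_j x_j^{a_{1,j}},\dots,\prod_j x_j^{a_{n,j}})$; one has $f_A^k=f_{A^k}$. $\mathrm{CDiv}_T(X)_{\mathbb{Q}}$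 is the $\mathbb{Q}$-vector space of $T$-invariant $\mathbb{Q}$-Cartier divisors (which on a simplicial toric variety equals $\bigoplus_{\tau\in\Sigma(1)}\mathbb{Q}\,V(\tau)$). Pull back: choose a refinement $\widetilde\Sigma$ of $\Sigma$ such that $A$ maps every cone of $\widetilde\Sigma$ into a cone of $\Sigma$; this gives a proper birational toric morphism $\pi:X(\widetilde\Sigma)\to X(\Sigma)$ (induced by the identity of $N$) and a toric morphism $\widetilde f_A:X(\widetilde\Sigma)\to X(\Sigma)$ (induced by $A$), and $f_A^*D:=\pi_*(\widetilde f_A^*D)$ (independent of the refinement), extended $\mathbb{Q}$-linearly to $\mathrm{CDiv}_T(X)_{\mathbb{Q}}$. A dominant toric rational map $f:X\dashrightarrow X$ is strongly algebraically stable if $(f^k)^*=(f^* )^k$ as maps of $\mathrm{CDiv}_T(X)_{\mathbb{Q}}$ for all positive integers $k$. *)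

(* Defs.v *)
From HB Require Import structures.
From mathcomp Require Import all_boot all_order all_algebra.
From mathcomp Require Import all_classical all_reals all_analysis.
From mathcomp Require Import complex.

Set Implicit Arguments.
Unset Strict Implicit.
Unset Printing Implicit Defensive.

Import Order.TTheory GRing.Theory Num.Theory.

Local Open Scope classical_set_scope.
Local Open Scope ring_scope.

(* A toric variety X(Sigma) is represented by its fan Sigma, a set of cones of
   N_R = 'cV[R]_n, where N = 'cV[int]_n, and M_Q is 'rV[rat]_n.  The toric
   rational map f_A is represented by the matrix A, so that f_A ^ k is
   represented by A ^+ k. *)

Notation intmx K A := (map_mx (intr : int -> K) A).

Section Fans.
Variables (R : realType) (n : nat).
Implicit Types (s t : set 'cV[R]_n) (Sigma : set (set 'cV[R]_n)).

Definition cone_of (k : nat) (V : 'M[R]_(n, k)) : set 'cV[R]_n :=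
  [set x | exists2 c : 'cV[R]_k, (forall i, 0 <= c i 0) & x = V *m c].

Definition rational_polyhedral s : Prop :=
  exists k (V : 'M[int]_(n, k)), s = cone_of (intmx R V).

Definition strongly_convex s : Prop := forall x, s x -> s (- x) -> x = 0.

Definition is_cone s : Prop := rational_polyhedral s /\ strongly_convex s.

Definition simplicial_cone s : Prop :=
  exists k (V : 'M[R]_(n, k)), row_free V^T /\ s = cone_of V.

Definition is_face t s : Prop :=
  exists2 u : 'rV[R]_n, (forall x, s x -> 0 <= (u *m x) 0 0)
                      & t = [set x | s x /\ (u *m x) 0 0 = 0].

Definition is_fan Sigma : Prop :=
  [/\ finite_set Sigma,
      forall s, Sigma s -> is_cone s,
      forall s t, Sigma s -> is_face t s -> Sigma t
    & forall s t, Sigma s -> Sigma t ->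
        is_face (s `&` t) s /\ is_face (s `&` t) t].

Definition support Sigma : set 'cV[R]_n := \bigcup_(s in Sigma) s.

Definition complete_fan Sigma : Prop := support Sigma = setT.

Definition simplicial_fan Sigma : Prop :=
  forall s, Sigma s -> simplicial_cone s.

Definition toric_birational_model Sigma : Prop :=
  [/\ is_fan Sigma, complete_fan Sigma & simplicial_fan Sigma].

Definition is_ray t : Prop :=
  exists2 v : 'cV[R]_n, v != 0 & t = [set c *: v | c in [set c : R | 0 <= c]].

Definition rays Sigma : set (set 'cV[R]_n) := [set t | Sigma t /\ is_ray t].

Definition ray_generator t : 'cV[int]_n :=
  xget 0 [set v | [/\ v != 0, t (intmx R v) &
    forall w : 'cV[int]_n, w != 0 -> t (intmx R w) ->
      \sum_i v i 0 ^+ 2 <= \sum_i w i 0 ^+ 2]].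

(* D t is the coefficient of the prime divisor V(t), for t a ray of Sigma. *)
Definition TDiv Sigma : Type := rays Sigma -> rat.

(* On the affine chart of the cone s, the divisor of the character m is
   \sum_t <m, v_t> V(t), where v_t is the generator of the ray t. *)
Definition local_equation Sigma (D : TDiv Sigma) s (m : 'rV[rat]_n) : Prop :=
  forall tau : rays Sigma, val tau `<=` s ->
    D tau = (m *m intmx rat (ray_generator (val tau))) 0 0.

Definition Q_Cartier Sigma (D : TDiv Sigma) : Prop :=
  forall s, Sigma s -> exists m, local_equation D s m.

Definition maps_cones (A : 'M[int]_n) Sigma' Sigma : Prop :=
  forall s', Sigma' s' ->
    exists2 s, Sigma s & [set intmx R A *m x | x in s'] `<=` s.

Definition refines Sigma' Sigma : Prop :=
  [/\ is_fan Sigma', support Sigma' = support Sigma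
    & forall s', Sigma' s' -> exists2 s, Sigma s & s' `<=` s].

(* Pull back of Q-Cartier divisors by the toric morphism X(Sigma') -> X(Sigma)
   induced by A: a local equation chi^m of D on the chart of s pulls back to
   chi^(m *m A) on the chart of s', whenever A maps s' into s. *)
Definition morphism_pullback (A : 'M[int]_n) Sigma' Sigma
    (D : TDiv Sigma) : TDiv Sigma' :=
  xget (fun=> 0) [set E : TDiv Sigma' | forall s' s m,
    Sigma' s' -> Sigma s -> [set intmx R A *m x | x in s'] `<=` s ->
    local_equation D s m -> local_equation E s' (m *m intmx rat A)].
Arguments morphism_pullback A Sigma' Sigma D : clear implicits.

(* Push forward by the birational morphism induced by a refinement: V(t) is
   sent to V(t) if t is a ray of Sigma, and is contracted otherwise. *)
Definition pushforward Sigma' Sigma (E : TDiv Sigma') : TDiv Sigma :=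
  fun tau => if insub (val tau) is Some tau' then E tau' else 0.
Arguments pushforward Sigma' Sigma E : clear implicits.

(* The refinement used to resolve f_A, chosen arbitrarily.  Local equations pull
   back to any refinement and the pull back of f_A does not depend on it, so it
   is not required to be simplicial.  When Sigma is a complete fan and A has a
   nonzero determinant, the cones s `&` A^-1(t), with s and t in Sigma, form
   such a refinement, so that the default value set0 is irrelevant. *)
Definition resolution (A : 'M[int]_n) Sigma : set (set 'cV[R]_n) :=
  xget set0 [set Sigma' | refines Sigma' Sigma /\ maps_cones A Sigma' Sigma].

Definition pullback (A : 'M[int]_n) Sigma (D : TDiv Sigma) : TDiv Sigma :=
  pushforward (resolution A Sigma) Sigma
    (morphism_pullback A (resolution A Sigma) Sigma D).
Arguments pullback A Sigma D : clear implicits.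

Definition strongly_algebraically_stable (A : 'M[int]_n) Sigma : Prop :=
  forall k : nat, (0 < k)%N -> forall D : TDiv Sigma, Q_Cartier D ->
    pullback (A ^+ k) Sigma D = iter k (pullback A Sigma) D.

End Fans.

Definition maximal_modulus_eigenvalue (R : realType) (n : nat)
    (A : 'M[int]_n) (lambda : R[i]) : Prop :=
  eigenvalue (intmx R[i] A) lambda /\
  forall mu : R[i], eigenvalue (intmx R[i] A) mu -> `|mu| <= `|lambda|.

Definition algebraic_multiplicity (R : realType) (n : nat)
    (A : 'M[int]_n) (lambda : R[i]) : nat :=
  mup lambda (char_poly (intmx R[i] A)).

(* Main.v *)
Require Import Defs.
From HB Require Import structures.
From mathcomp Require Import all_boot all_order all_algebra.
From mathcomp Require Import all_classical all_reals all_analysis.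
From mathcomp Require Import complex ring lra.

(** A divisor D on a complete simplicial fan is the same thing as a function
    psi_D that is linear on each cone, its values at the ray generators being
    the coefficients of D, and the coefficient of f_A^* D along a ray with
    generator v is psi_D(A v) ([pullbackE]).  For this one has to know that f_A
    can be resolved ([resolution_exists]), which rests on the fact that the
    intersection of rational cones is again finitely generated
    ([gen_cone_halfspace]).  Strong algebraic stability then says that
    interpolating psi_D o A linearly from the rays, k times in a row, gives the
    values of psi_D o A^k at the rays.

    A dominant simple real eigenvalue lambda.  Up to a smaller exponential,
    A^k = lambda^k v xi, where v and xi are the right and left eigenvectors
    ([dominant_projection]).  Choose a basis W of lattice vectors so close to
    v (or to -v) that this vector lies inside the simplicial cone of W and xi
    does not change sign on it ([integral_simplex_near]).  For large even k the
    matrix of A^k in this basis is positive, so on the fan of all orthants of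
    this basis A^k preserves two opposite orthants and sends every ray into one
    of them ([orthant_fan_stable]).  There psi_D and its iterated pull backs are linear,
    and no interpolation error can occur ([stable_of_invariant_cones]).

    A dominant pair rotating irrationally.  Suppose that f_A is stable on a fan,
    and follow the orbit A^j v of a ray generator that has a component along the
    dominant eigenplane.  Testing stability on prime divisors shows that A maps
    the minimal cone around each point of the orbit into the minimal cone around
    the next one ([stable_maps_cone]).  As there are finitely many cones, some
    power A^m preserves a cone containing a point x of the orbit
    ([stable_periodic_cone]).  But in the direction of the eigenplane the points
    A^(m j) x rotate by an irrational angle, which is impossible in a strongly
    convex cone.  Concretely, doubling the angle one finds a multiple K of m with
    Re(lambda^K) <= 0 ([cos_doubling_le0]), and then a quadratic polynomial in
    A^K with nonnegative coefficients kills the dominant part, which no nonzero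
    dominant component of a point of an invariant cone can survive
    ([spiralling_leaves_cone]). *)

Set Implicit Arguments.
Unset Strict Implicit.
Unset Printing Implicit Defensive.

Import Order.TTheory GRing.Theory Num.Theory.

Local Open Scope classical_set_scope.
Local Open Scope ring_scope.

(** * Growth of the powers of a matrix *)

(** A perturbed recurrence x_(k+1) = mu x_k + O(r^k) with |mu| < r cannot grow
    faster than r^k: the choice c <= d (r - |mu|) makes the bound d r^k
    propagate. *)
Lemma recurrence_bound (C : numFieldType) (mu r c d : C) (x : nat -> C) :
    `|mu| < r -> `|x 0%N| <= d -> c <= d * (r - `|mu|) ->
    (forall k, `|x k.+1 - mu * x k| <= c * r ^+ k) ->
  forall k, `|x k| <= d * r ^+ k.
Proof.
move=> mur x0 cd xS; have r0 : 0 <= r by rewrite (le_trans _ (ltW mur)).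
elim=> [|k IH]; first by rewrite expr0 mulr1.
rewrite -[x k.+1](subrK (mu * x k)) (le_trans (ler_normD _ _)) //.
rewrite normrM (le_trans (lerD (xS k) (ler_wpM2l (normr_ge0 mu) IH))) //.
rewrite exprS -subr_ge0.
have -> : d * (r * r ^+ k) - (c * r ^+ k + `|mu| * (d * r ^+ k)) =
          (d * (r - `|mu|) - c) * r ^+ k by ring.
by rewrite mulr_ge0 ?exprn_ge0 ?subr_ge0.
Qed.

Definition geom_bounded (C : numFieldType) m p (r : C)
    (X : nat -> 'M[C]_(m, p)) :=
  exists d, forall k i j, `|X k i j| <= d * r ^+ k.

Lemma geom_bounded_mulmxl (C : numFieldType) l m p (r : C)
    (L : 'M[C]_(l, m)) (X : nat -> 'M[C]_(m, p)) :
  geom_bounded r X -> geom_bounded r (fun k => L *m X k).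
Proof.
move=> [d Xd]; exists (\sum_i \sum_j `|L i j| * d) => k i j.
have d0 (i' : 'I_m) : 0 <= d.
  by have := Xd 0%N i' j; rewrite expr0 mulr1; apply: le_trans.
rewrite mxE (le_trans (ler_norm_sum _ _ _)) // mulr_suml (bigD1 i) //=.
rewrite mulr_suml ler_wpDr //; last first.
  by apply: ler_sum => j' _; rewrite normrM -mulrA ler_wpM2l.
case: m L X Xd d0 => [|m] L X Xd d0.
  by apply: sumr_ge0 => i' _; rewrite big_ord0 mul0r.
have rk : 0 <= d * r ^+ k by rewrite (le_trans _ (Xd k ord0 j)).
apply: sumr_ge0 => i' _; rewrite mulr_suml; apply: sumr_ge0 => j' _.
by rewrite -mulrA mulr_ge0.
Qed.

Lemma geom_bounded_mulmxr (C : numFieldType) m p q (r : C)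
    (L : 'M[C]_(p, q)) (X : nat -> 'M[C]_(m, p)) :
  geom_bounded r X -> geom_bounded r (fun k => X k *m L).
Proof.
move=> [d Xd].
have [|e He] := @geom_bounded_mulmxl C q p m r L^T (fun k => (X k)^T).
  by exists d => k i j; rewrite mxE.
by exists e => k i j; have := He k j i; rewrite -trmx_mul mxE.
Qed.

(** The substitute for the Jordan form.  If X_k = M^k N, then
    X_(k+1) - mu X_k = M^k (M - mu) N, and (M - mu) N is annihilated by one
    linear factor less, so the factors can be peeled off one at a time. *)
Lemma geom_bounded_annihilated (C : numFieldType) n p (M : 'M[C]_n.+1)
    (rs : seq C) (r : C) (N : 'M[C]_(n.+1, p)) :
    0 < r -> all (fun mu => `|mu| < r) rs ->
    horner_mx M (\prod_(mu <- rs) ('X - mu%:P)) *m N = 0 ->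
  geom_bounded r (fun k => M ^+ k *m N).
Proof.
move=> r0; elim: rs N => [|mu rs IH] N /=.
  rewrite big_nil rmorph1 mul1mx => _ ->; exists 0 => k i j.
  by rewrite mulmx0 mxE normr0 mul0r.
move=> /andP[mur rsr]; rewrite big_cons mulrC rmorphM /= -mulmxE -mulmxA => H0.
have [c Hc] := IH _ rsr H0.
set d := \sum_i \sum_j `|N i j| + `|c| / (r - `|mu|).
have rmu : 0 < r - `|mu| by rewrite subr_gt0.
exists d => k i j.
apply: (@recurrence_bound C mu r c d (fun k => (M ^+ k *m N) i j)) => //.
- rewrite expr0 mul1mx /d (bigD1 i) //= (bigD1 j) //= -!addrA ler_wpDr //.
  by rewrite !addr_ge0 ?sumr_ge0 // => *; rewrite ?sumr_ge0 // divr_ge0 // ltW.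
- have c0 : 0 <= c by have := Hc 0%N i j; rewrite expr0 mulr1; apply: le_trans.
  rewrite /d mulrDl divfK ?gt_eqF // (ger0_norm c0) ler_wpDl //.
  rewrite mulr_ge0 ?(ltW rmu) //.
  by rewrite sumr_ge0 // => *; rewrite sumr_ge0.
- move=> {}k; apply: le_trans (Hc k i j); rewrite le_eqVlt; apply/orP; left.
  apply/eqP; congr (`|_|).
  rewrite rmorphB /= horner_mx_X horner_mx_C mulmxBl mulmxBr mul_scalar_mx.
  by rewrite -scalemxAr exprSr -mulmxE -mulmxA !mxE.
Qed.

Lemma char_poly_conj (F : fieldType) n (P M : 'M[F]_n) : P \in unitmx ->
  char_poly (P *m M *m invmx P) = char_poly M.
Proof.
move=> Pu; rewrite /char_poly.
have -> : char_poly_mx (P *m M *m invmx P) =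
    map_mx polyC P *m char_poly_mx M *m map_mx polyC (invmx P).
  rewrite /char_poly_mx mulmxBr mulmxBl !map_mxM /=; congr (_ - _).
  by rewrite scalar_mxC -mulmxA -map_mxM mulmxV // map_mx1 mulmx1.
rewrite !det_mulmx !det_map_mx mulrAC -rmorphM /= -det_mulmx mulmxV //.
by rewrite det1 mul1r.
Qed.

(** In a basis starting with y the matrix M becomes block triangular with first
    block a, so char_poly M is X - a times the characteristic polynomial of the
    other block.  A second independent eigenvector would give an eigenvector of
    that block, and a would be a double root. *)
Lemma simple_eigenspace_line (F : fieldType) n (M : 'M[F]_n) a
    (y z : 'rV[F]_n) :
    mup a (char_poly M) = 1%N -> y != 0 -> y *m M = a *: y ->
    z *m M = a *: z ->
  exists c, z = c *: y.
Proof.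
case: n M y z => [|n] M y z; first by rewrite [y]thinmx0 eqxx.
rewrite -[n.+1]/(1 + n)%N in M y z *.
move=> mupa y0 yM zM; set P := row_ebase y.
have Pu : P \in unitmx := row_ebase_unit y.
have ry : \rank y = 1%N by rewrite rank_rV y0.
have [b yb] : exists b, y = b *: row_mx 1%:M 0 *m P.
  exists (col_ebase y 0 0); rewrite -[y in LHS]mulmx_ebase ry.
  by rewrite pid_mx_row [col_ebase y]mx11_scalar mul_scalar_mx mxE eqxx mulr1n.
have b0 : b != 0 by apply: contraNneq y0 => b0; rewrite yb b0 scale0r mul0mx.
pose N := P *m M *m invmx P.
have eN : row_mx 1%:M 0 *m N = a *: row_mx 1%:M 0 :> 'rV_(1 + n).
  have -> : row_mx 1%:M 0 = b^-1 *: (y *m invmx P) :> 'rV_(1 + n).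
    by rewrite yb -mulmxA mulmxV // mulmx1 scalerA mulVf ?scale1r.
  rewrite /N -scalemxAl !mulmxA mulmxKV //.
  by rewrite yM -scalemxAl !scalerA mulrC.
have zN : (z *m invmx P) *m N = a *: (z *m invmx P).
  by rewrite /N !mulmxA mulmxKV // zM -scalemxAl.
have cN : char_poly N = char_poly M by apply: char_poly_conj.
rewrite -{}cN in mupa; clearbody N.
move: eN zN mupa.
rewrite -[N]submxK -[z *m _]hsubmxK.
set z0 := lsubmx _; set z1 := rsubmx _; set Nul := ulsubmx _.
set Nur := ursubmx _; set Ndl := dlsubmx _; set Ndr := drsubmx _.
rewrite !mul_row_block !scale_row_mx !mul1mx !mul0mx !addr0 scaler0.
move=> /eq_row_mx[-> ->]; rewrite mulmx0 add0r => /eq_row_mx[_ zN] mupa.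
have z10 : z1 = 0.
  apply/eqP/negP => /negP z10.
  have : eigenvalue Ndr a by apply/eigenvalueP; exists z1.
  rewrite eigenvalue_root_char => rD.
  move: mupa; rewrite /char_poly /char_poly_mx map_block_mx.
  rewrite (scalar_mx_block 1 n 'X).
  rewrite opp_block_mx add_block_mx map_mx0 oppr0 addr0 det_lblock.
  rewrite -[X in X * _]/(char_poly _) -[X in _ * X]/(char_poly _).
  have -> : char_poly (a *: 1%:M : 'M[F]_1) = 'X - a%:P.
    by rewrite /char_poly det_mx11 !mxE eqxx mulr1 mulr1n.
  rewrite mupM ?polyXsubC_eq0 ?monic_neq0 ?char_poly_monic //.
  have -> : mup a ('X - a%:P) = 1%N by rewrite -['X - _]expr1 mup_XsubCX eqxx.
  move: rD; rewrite -dvdp_XsubCl XsubC_dvd ?monic_neq0 ?char_poly_monic //.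
  by case: mup.
have zP : z = row_mx z0 z1 *m P by rewrite hsubmxK mulmxKV.
exists (z0 0 0 / b); rewrite zP z10 yb -scalemxAl scalerA divfK //.
by rewrite scalemxAl scale_row_mx scaler0 scalemx1 -mx11_scalar.
Qed.

Lemma norm_gap (C : numFieldType) (L : C) (s : seq C) :
    0 < L -> all (fun mu => `|mu| < L) s ->
  exists r, [/\ 0 < r, r < L & all (fun mu => `|mu| < r) s].
Proof.
move=> L0; elim: s => [_|mu s IH /= /andP[muL sL]].
  by exists (L / 2%:R); rewrite divr_gt0 ?ltr0n // ltr_pdivrMr ?ltr0n //
    mulr_natr mulr2n ltrDl.
have [r [r0 rL sr]] := IH sL.
have [mur|] := boolP (`|mu| < r); first by exists r; rewrite r0 rL /= mur sr.
rewrite -real_leNgt ?normr_real ?gtr0_real // => rmu.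
exists ((`|mu| + L) / 2%:R); rewrite midf_lt // divr_gt0 ?ltr0n ?ltr_wpDl //=.
rewrite midf_lt //=; split => //; apply: sub_all sr => nu /lt_le_trans; apply.
exact: le_trans rmu (ltW (midf_lt muL).1).
Qed.

(** Write char_poly M = P S, where P is the product over ls; all roots of S are
    less than L in modulus, hence less than some r < L.  By Cayley-Hamilton S
    annihilates every matrix of the form P(M) g(M), so the powers of M grow at
    most like r^k on its columns. *)
Lemma spectral_gap (C : numClosedFieldType) n (M : 'M[C]_n.+1) (ls : seq C)
    (L : C) : uniq ls -> 0 < L ->
    (forall l, l \in ls -> mup l (char_poly M) = 1%N) ->
    (forall mu, eigenvalue M mu -> mu \notin ls -> `|mu| < L) ->
  exists r, [/\ 0 < r, r < L & forall g : {poly C},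
    geom_bounded r (fun k => M ^+ k *m
      horner_mx M (\prod_(l <- ls) ('X - l%:P) * g))].
Proof.
move=> uls L0 mls mL.
have [s sE] := closed_field_poly_normal (char_poly M).
rewrite (monicP (char_poly_monic M)) scale1r in sE.
pose s' := [seq x <- s | x \notin ls].
have ss : perm_eq s (ls ++ s').
  apply: (@perm_trans _ ([seq x <- s | mem ls x] ++ s')).
    by rewrite perm_sym perm_filterC.
  rewrite perm_cat2r uniq_perm //.
    apply: count_mem_uniq => x; rewrite mem_filter /=.
    rewrite count_filter; case: (boolP (x \in ls)) => xls /=.
      have := mls _ xls; rewrite sE mu_prod_XsubC => c1.
      rewrite (_ : count _ s = count_mem x s); last first.
        by apply: eq_count => y /=; case: eqP => // ->; rewrite xls.
      by rewrite c1 -has_pred1 has_count c1.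
    by apply/eqP; rewrite -leqn0 -(count_pred0 s) sub_count // => y /=;
      case: eqP => // ->; rewrite (negbTE xls).
  move=> x; rewrite mem_filter /=; case: (boolP (x \in ls)) => //= xls.
  have := mls _ xls; rewrite sE mu_prod_XsubC => c1.
  by rewrite -has_pred1 has_count c1.
have [r [r0 rL sr]] : exists r, [/\ 0 < r, r < L & all (fun mu => `|mu| < r) s'].
  apply: norm_gap => //; apply/allP => mu; rewrite mem_filter => /andP[muls mus].
  by apply: mL => //; rewrite eigenvalue_root_char sE root_prod_XsubC.
exists r; split=> // g; apply: (geom_bounded_annihilated r0 sr).
rewrite mulmxE -rmorphM /= mulrA [X in X * g]mulrC -big_cat /=.
by rewrite -(perm_big _ ss) -sE rmorphM /= Cayley_Hamilton mul0r.
Qed.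

Lemma normcR (R : rcfType) (x : R) : `|x%:C%C| = (`|x|)%:C%C.
Proof. by rewrite normc_def /= expr0n addr0 sqrtr_sqr. Qed.

Lemma geom_bounded_real (R : rcfType) m p (r : R[i]) (X : nat -> 'M[R]_(m, p)) :
    0 < r -> geom_bounded r (fun k => map_mx (real_complex R) (X k)) ->
  geom_bounded (complex.Re r) X.
Proof.
move=> r0 [d Xd]; exists (complex.Re d) => k i j.
have rE : r = (complex.Re r)%:C%C by rewrite RRe_real ?gtr0_real.
have := Xd k i j; rewrite mxE normcR rE -rmorphXn /= => Hk.
have dE : d = (complex.Re d)%:C%C.
  rewrite RRe_real // ger0_real //.
  have := Xd 0%N i j; rewrite expr0 mulr1; exact: le_trans.
by move: Hk; rewrite dE -rmorphM lecR.
Qed.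

(** If char_poly M = (X - l) q, then E = q(M) / q(l) is the spectral projection
    for l.  Since 1 - E is a multiple of M - l, the other eigenvalues govern
    M^k (1 - E), whereas M^k E = l^k E.  The rows of E are left eigenvectors
    for the simple eigenvalue l, hence multiples of a single one xi, so that
    E = v xi; and xi E = xi amounts to xi v = 1. *)
Lemma dominant_projection (R : rcfType) n (M : 'M[R]_n.+1) (l : R) :
    l != 0 -> eigenvalue M l ->
    mup l%:C%C (char_poly (map_mx (real_complex R) M)) = 1%N ->
    (forall mu, eigenvalue (map_mx (real_complex R) M) mu -> mu != l%:C%C ->
      `|mu| < `|l%:C%C|) ->
  exists (v : 'cV[R]_n.+1) (xi : 'rV[R]_n.+1) (r : R),
    [/\ 0 < r < `|l|, xi *m v = 1%:M
      & geom_bounded r (fun k => M ^+ k - l ^+ k *: (v *m xi))].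
Proof.
move=> l0 eMl mul gap; set MC := map_mx _ M in mul gap.
have [q pE] : exists q, char_poly M = q * ('X - l%:P).
  by apply/factor_theorem; rewrite -eigenvalue_root_char.
have cMC : char_poly MC = map_poly (real_complex R) (char_poly M).
  by rewrite map_char_poly.
have ql0 : q.[l] != 0.
  apply/eqP => /eqP ql; have /factor_theorem[q' qE] : root q l by [].
  have : (mup l%:C%C (char_poly MC) < 2)%N by rewrite mul.
  rewrite mup_ltn; last by rewrite monic_neq0 ?char_poly_monic.
  move=> /negP; apply.
  rewrite cMC pE qE !rmorphM /= !map_polyXsubC -mulrA -expr2.
  exact: dvdp_mull.
have muR : mup l (char_poly M) = 1%N.
  by rewrite pE mupMr // -['X - _]expr1 mup_XsubCX eqxx.
have [g gE] : exists g, 1 - q.[l]^-1 *: q = g * ('X - l%:P).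
  apply/factor_theorem; rewrite rootE !hornerE.
  by rewrite mulVf // subrr.
pose E := q.[l]^-1 *: horner_mx M q.
have EC : 1 - E = horner_mx M ('X - l%:P) *m horner_mx M g.
  rewrite mulmxE -rmorphM /= mulrC -gE rmorphB /= rmorph1 /E.
  by rewrite horner_mxZ.
have ME : E *m M = l *: E.
  have : horner_mx M (q * ('X - l%:P)) = 0 by rewrite -pE Cayley_Hamilton.
  rewrite rmorphM rmorphB /= horner_mx_X horner_mx_C -mulmxE mulmxBr.
  rewrite mul_mx_scalar => /eqP; rewrite subr_eq0 => /eqP H.
  by rewrite /E -scalemxAl H !scalerA mulrC.
have /eigenvalueP[xi xiM xi0] := eMl.
have xiE : xi *m E = xi.
  apply/eqP; rewrite eq_sym -subr_eq0; apply/eqP.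
  rewrite -[X in X - _]mulmx1 -mulmxBr EC mulmxA rmorphB /= horner_mx_X.
  by rewrite horner_mx_C mulmxBr xiM mul_mx_scalar subrr mul0mx.
have [v vE] : exists v : 'cV[R]_n.+1, E = v *m xi.
  have /fin_all_exists[c cE] : forall i, exists c, row i E = c *: xi.
    move=> i; apply: (simple_eigenspace_line muR xi0 xiM).
    by rewrite -row_mul ME linearZ.
  exists (\col_i c i); apply/row_matrixP => i.
  by rewrite cE row_mul -mul_scalar_mx; congr (_ *m _); apply/rowP => j;
    rewrite ord1 !mxE eqxx.
have vxi : xi *m v = 1%:M.
  have : (xi *m v) *m xi = 1%:M *m xi by rewrite -mulmxA -vE mul1mx.
  rewrite [xi *m v]mx11_scalar !mul_scalar_mx scale1r -[RHS]scale1r => /eqP.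
  by rewrite -subr_eq0 -scalerBl scaler_eq0 (negbTE xi0) orbF subr_eq0 => /eqP->.
have lC0 : 0 < `|l%:C%C| by rewrite normr_gt0 (inj_eq (@complexI _)).
have mlC l' : l' \in [:: l%:C%C] -> mup l' (char_poly MC) = 1%N.
  by rewrite inE => /eqP->.
have gapC mu : eigenvalue MC mu -> mu \notin [:: l%:C%C] -> `|mu| < `|l%:C%C|.
  by move=> emu; rewrite inE; apply: gap.
have [r [r0 rL br]] := @spectral_gap R[i] n MC [:: l%:C%C] _ isT lC0 mlC gapC.
exists v, xi, (complex.Re r); split=> //.
  rewrite -!(@ltcR R) RRe_real ?gtr0_real // r0 /=.
  by rewrite -normcR.
apply: geom_bounded_real => //.
have [d Hd] := br (map_poly (real_complex R) g).
exists d => k i j; apply: le_trans (Hd k i j); rewrite le_eqVlt; apply/orP; left.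
apply/eqP; congr (`|fun_of_matrix _ _ _|).
rewrite big_seq1 -map_polyXsubC -rmorphM /= -map_horner_mx -rmorphXn /= -map_mxM.
congr map_mx; rewrite rmorphM /= -mulmxE -EC mulmxBr mulmx1 -vE; congr (_ - _).
elim: k => [|k IH]; first by rewrite !expr0 mul1mx scale1r.
have ME' : M *m E = l *: E.
  rewrite -ME /E -scalemxAl -scalemxAr; congr (_ *: _).
  exact/comm_mx_horner.
by rewrite exprS -scalerA IH scalemxAr -ME' mulmxA mulmxE -exprSr.
Qed.

(** * Rational polyhedral cones *)

Section Cones.
Variables (R : realType) (n : nat).
Implicit Types (s t : set 'cV[R]_n) (x y : 'cV[R]_n).

Definition cone_closed s : Prop :=
  [/\ s 0, forall x y, s x -> s y -> s (x + y)
    & forall (a : R) x, 0 <= a -> s x -> s (a *: x)].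

Lemma cone_closed_sum s (I : finType) (c : I -> R) (F : I -> 'cV[R]_n) :
  cone_closed s -> (forall i, 0 <= c i) -> (forall i, s (F i)) ->
  s (\sum_i c i *: F i).
Proof.
move=> [s0 sD sZ] c0 sF; elim/big_ind: _ => // i _; exact: sZ.
Qed.

(** The same cones as [cone_of], but with generators indexed by any finite
    type: cutting a cone by a half-space uses pairs of generators as indices. *)
Definition gen_cone (J : finType) (F : J -> 'cV[R]_n) : set 'cV[R]_n :=
  [set x | exists2 c : J -> R, forall j, 0 <= c j & x = \sum_j c j *: F j].

Lemma gen_cone_closed (J : finType) (F : J -> 'cV[R]_n) :
  cone_closed (gen_cone F).
Proof.
split.
- by exists (fun=> 0) => //; rewrite big1 // => j _; rewrite scale0r.
- move=> _ _ [c c0 ->] [d d0 ->]; exists (fun j => c j + d j).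
    by move=> j; rewrite addr_ge0.
  by rewrite -big_split /=; apply: eq_bigr => j _; rewrite scalerDl.
- move=> a _ a0 [c c0 ->]; exists (fun j => a * c j).
    by move=> j; rewrite mulr_ge0.
  by rewrite scaler_sumr; apply: eq_bigr => j _; rewrite scalerA.
Qed.

Lemma gen_cone_gen (J : finType) (F : J -> 'cV[R]_n) j : gen_cone F (F j).
Proof.
exists (fun i => (i == j)%:R) => [i|]; first exact: ler0n.
rewrite (bigD1 j) //= eqxx scale1r big1 ?addr0 // => i /negbTE ->.
by rewrite scale0r.
Qed.

Lemma mulmx_col_sum k (V : 'M[R]_(n, k)) (c : 'cV[R]_k) :
  V *m c = \sum_j c j 0 *: col j V.
Proof.
apply/colP => i; rewrite summxE mxE; apply: eq_bigr => j _.
by rewrite !mxE mulrC.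
Qed.

Lemma cone_of_gen k (V : 'M[R]_(n, k)) : cone_of V = gen_cone (fun j => col j V).
Proof.
apply/seteqP; split=> [_ [c c0 ->]|_ [c c0 ->]].
  by exists (fun j => c j 0) => //; rewrite mulmx_col_sum.
exists (\col_j c j) => [j|]; first by rewrite mxE.
by rewrite mulmx_col_sum; apply: eq_bigr => j _; rewrite mxE.
Qed.

Lemma rational_polyhedral_gen (J : finType) (F : J -> 'cV[int]_n) :
  rational_polyhedral (gen_cone (fun j => intmx R (F j))).
Proof.
pose V : 'M[int]_(n, #|J|) := \matrix_(i, j) F (enum_val j) i 0.
have colE j : col j (intmx R V) = intmx R (F (enum_val j)).
  by apply/colP => i; rewrite !mxE.
have bij := onW_bij xpredT (enum_val_bij J).
exists #|J|, V; rewrite cone_of_gen.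
apply/seteqP; split=> [_ [c c0 ->]|_ [c c0 ->]].
  exists (fun j => c (enum_val j)) => //.
  by rewrite (reindex _ bij) /=; apply: eq_bigr => j _; rewrite colE.
exists (fun j => c (enum_rank j)) => //.
by rewrite [RHS](reindex _ bij); apply: eq_bigr => j _; rewrite colE enum_valK.
Qed.

(** One step of the double description method: the generators on the good side
    of the hyperplane are kept, and each segment joining a generator on the
    positive side to one on the negative side is cut at the hyperplane. *)
Definition halfspace_gen (K : realDomainType) (J : finType)
    (F : J -> 'cV[K]_n) (u : 'rV[K]_n) (p : J + J * J) : 'cV[K]_n :=
  let a j := (u *m F j) 0 0 in
  match p with
  | inl j => if 0 <= a j then F j else 0
  | inr (i, j) => if (0 < a i) && (a j < 0) then a i *: F j - a j *: F i else 0
  end.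

(** For a point sum_j c_j F_j of the half-space, let P and N be the total
    heights of its positive and negative parts, so that N <= P.  The cut points
    of the pairs (i, j), weighted by c_i c_j / P, use up all of the negative
    part and the proportion N / P of the positive one. *)
Lemma gen_cone_halfspace (J : finType) (F : J -> 'cV[R]_n) (u : 'rV[R]_n) :
  gen_cone F `&` [set x | 0 <= (u *m x) 0 0] = gen_cone (halfspace_gen F u).
Proof.
set a := fun j => (u *m F j) 0 0.
apply/seteqP; split=> [_ [[c c0 ->]]|x [c c0 ->]] /=; last first.
  suff H p : gen_cone F (halfspace_gen F u p) /\
             0 <= (u *m halfspace_gen F u p) 0 0.
    split.
      by apply: (cone_closed_sum (gen_cone_closed F)) => // p; have [] := H p.
    rewrite mulmx_sumr summxE sumr_ge0 // => p _; rewrite -scalemxAr mxE.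
    by rewrite mulr_ge0 //; have [] := H p.
  have [G0 GD GZ] := gen_cone_closed F.
  case: p => [j|[i j]] /=.
    by case: ifP => // aj; [split=> //; apply: gen_cone_gen|rewrite mulmx0 mxE].
  case: ifP => [/andP[ai aj]|_]; last by rewrite mulmx0 mxE; split.
  split; last by rewrite mulmxBr -!scalemxAr !mxE /= mulrC subrr.
  rewrite -scaleNr; apply: GD; apply: GZ; rewrite ?oppr_ge0 ?ltW //;
    exact: gen_cone_gen.
have -> : (u *m (\sum_j c j *: F j)) 0 0 = \sum_j c j * a j.
  by rewrite mulmx_sumr summxE; apply: eq_bigr => j _; rewrite -scalemxAr mxE.
move=> ux0.
pose P := \sum_(j | 0 < a j) c j * a j.
pose N := \sum_(j | a j < 0) c j * - a j.
have split3 (V : zmodType) (f : J -> V) : \sum_j f j =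
    \sum_(j | 0 < a j) f j + \sum_(j | a j < 0) f j + \sum_(j | a j == 0) f j.
  rewrite (bigID (fun j => 0 < a j)) /= -addrA; congr (_ + _).
  rewrite (bigID (fun j => a j < 0)) /=; congr (_ + _); apply: eq_bigl => j;
  by case: (ltgtP (a j) 0).
have NP : N <= P.
  move: ux0; rewrite split3 [X in _ + X]big1 ?addr0; last first.
    by move=> j /eqP ->; rewrite mulr0.
  have -> : \sum_(j | a j < 0) c j * a j = - N.
    by rewrite /N -sumrN; apply: eq_bigr => j _; rewrite mulrN opprK.
  by rewrite subr_ge0.
have P0 : 0 <= P by apply: sumr_ge0 => j aj; rewrite mulr_ge0 // ltW.
have N0 : 0 <= N.
  by apply: sumr_ge0 => j aj; rewrite mulr_ge0 // oppr_ge0 ltW.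
exists (fun p => match p with
  | inl j => if 0 < a j then c j * (1 - N / P) else c j
  | inr (i, j) => c i * c j / P end).
  case=> [j|[i j]]; last by rewrite divr_ge0 ?mulr_ge0.
  case: ifP => // _; rewrite mulr_ge0 // subr_ge0.
  have [->|Pn0] := eqVneq P 0; first by rewrite invr0 mulr0 ler01.
  by rewrite ler_pdivrMr ?mul1r // lt_def Pn0.
rewrite big_sumType -[RHS]/(_ + _) !split3.
have -> : \sum_(j | 0 < a j) (if 0 < a j then c j * (1 - N / P) else c j) *:
    halfspace_gen F u (inl j) = \sum_(j | 0 < a j) (c j * (1 - N / P)) *: F j.
  by apply: eq_bigr => j aj; rewrite /= -/(a j) aj (ltW aj).
have -> : \sum_(j | a j < 0) (if 0 < a j then c j * (1 - N / P) else c j) *: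
    halfspace_gen F u (inl j) = 0.
  by apply: big1 => j aj; rewrite /= -/(a j) (lt_geF aj) scaler0.
have -> : \sum_(j | a j == 0) (if 0 < a j then c j * (1 - N / P) else c j) *:
    halfspace_gen F u (inl j) = \sum_(j | a j == 0) c j *: F j.
  by apply: eq_bigr => j /eqP aj; rewrite /= -/(a j) aj ltxx lexx.
have -> : \sum_(p : J * J)
   (let (i, j) := p in c i * c j / P) *: halfspace_gen F u (inr p) =
   \sum_(i | 0 < a i) \sum_(j | a j < 0)
     (c i * c j / P) *: (a i *: F j - a j *: F i).
  rewrite pair_big /= [RHS]big_mkcond /=; apply: eq_bigr => -[i j] _ /=.
  by rewrite -/(a i) -/(a j); case: ifP => _ //; rewrite scaler0.
rewrite addr0.
have [P00|Pn0] := eqVneq P 0.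
  have N00 : N = 0 by apply/eqP; rewrite eq_le N0 -{1}P00 NP.
  rewrite [X in _ = _ + X]big1; last first.
    move=> i _; rewrite big1 // => j _.
    by rewrite P00 invr0 mulr0 scale0r.
  rewrite P00 invr0 mulr0 subr0 [X in _ + X + _]big1 ?addr0.
    by congr (_ + _); apply: eq_bigr => j _; rewrite mulr1.
  move=> j aj.
  have H := @psumr_eq0P _ _ (fun j => a j < 0) (fun j => c j * - a j) _ N00 j aj.
  have /eqP : c j * - a j = 0.
    by apply: H => i ai; rewrite mulr_ge0 // oppr_ge0 ltW.
  by rewrite mulf_eq0 oppr_eq0 (lt_eqF aj) orbF => /eqP ->; rewrite scale0r.
have -> : \sum_(i | 0 < a i) \sum_(j | a j < 0)
     (c i * c j / P) *: (a i *: F j - a j *: F i) =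
  \sum_(j | a j < 0) c j *: F j + (N / P) *: \sum_(i | 0 < a i) c i *: F i.
  have -> : \sum_(j | a j < 0) c j *: F j =
      (P / P) *: \sum_(j | a j < 0) c j *: F j by rewrite divff // scale1r.
  rewrite {1}/P exchange_big /= mulr_suml scaler_suml exchange_big /=.
  rewrite /N mulr_suml scaler_suml.
  under [X in _ = _ + X]eq_bigr do rewrite scaler_sumr.
  rewrite [X in _ = _ + X]exchange_big /= -big_split /=; apply: eq_bigr => i ai.
  rewrite scaler_sumr -big_split /=; apply: eq_bigr => j aj.
  rewrite scalerBr !scalerA -scaleNr; congr (_ *: _ + _ *: _); ring.
have -> : \sum_(j | 0 < a j) (c j * (1 - N / P)) *: F j =
    \sum_(j | 0 < a j) c j *: F j - (N / P) *: \sum_(j | 0 < a j) c j *: F j.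
  rewrite scaler_sumr -sumrB; apply: eq_bigr => j _.
  by rewrite scalerA -scalerBl mulrBr mulr1 [c j * (N / P)]mulrC.
rewrite [X in _ = _ + X]addrC addrA [X in _ = X + _]addrAC subrK.
by rewrite addrAC.
Qed.

Lemma halfspace_gen_int (J : finType) (F : J -> 'cV[int]_n) (u : 'rV[int]_n) p :
  intmx R (halfspace_gen F u p) =
  halfspace_gen (fun j => intmx R (F j)) (intmx R u) p.
Proof.
have aE j : (intmx R u *m intmx R (F j)) 0 0 = ((u *m F j) 0 0)%:~R.
  by rewrite -map_mxM mxE.
case: p => [j|[i j]] /=; rewrite !aE.
  by rewrite ler0z; case: ifP; rewrite ?map_mx0.
rewrite ltr0z ltrz0; case: ifP => _; last by rewrite map_mx0.
by rewrite map_mxB !map_mxZ.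
Qed.

Lemma rational_polyhedral_halfspace s (u : 'rV[int]_n) :
  rational_polyhedral s ->
  rational_polyhedral (s `&` [set x | 0 <= (intmx R u *m x) 0 0]).
Proof.
move=> [k [V ->]]; rewrite cone_of_gen.
have -> : (fun j => col j (intmx R V)) = (fun j => intmx R (col j V)).
  by apply/funext => j; rewrite map_col.
rewrite gen_cone_halfspace.
have <- : (fun p => intmx R (halfspace_gen (fun j => col j V) u p)) =
          halfspace_gen (fun j => intmx R (col j V)) (intmx R u).
  by apply/funext => p; rewrite halfspace_gen_int.
exact: rational_polyhedral_gen.
Qed.

Definition halfspaces (us : seq 'rV[int]_n) : set 'cV[R]_n :=
  [set x | forall u, u \in us -> 0 <= (intmx R u *m x) 0 0].

Lemma rational_polyhedral_halfspaces s us :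
  rational_polyhedral s -> rational_polyhedral (s `&` halfspaces us).
Proof.
elim: us s => [|u us IH] s ps.
  by rewrite (_ : halfspaces [::] = setT) ?setIT // -subTset => x _ u.
rewrite (_ : halfspaces (u :: us) =
    [set x | 0 <= (intmx R u *m x) 0 0] `&` halfspaces us).
  by rewrite setIA; apply/IH/rational_polyhedral_halfspace.
apply/seteqP; split=> x.
  by move=> H; split=> [|w wus]; apply: H; rewrite inE ?eqxx // wus orbT.
by move=> [H0 H] w; rewrite inE => /orP[/eqP->|] //; apply: H.
Qed.

Lemma intmx_common_denominator p q (Q : 'M[rat]_(p, q)) :
  exists (d : int) (Z : 'M[int]_(p, q)), 0 < d /\ d%:~R *: Q = intmx rat Z.
Proof.
exists (\prod_(e : 'I_p * 'I_q) denq (Q e.1 e.2)).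
exists (\matrix_(i, j) (numq (Q i j) *
  \prod_(e : 'I_p * 'I_q | e != (i, j)) denq (Q e.1 e.2))).
split; first by apply: prodr_gt0 => e _; apply: denq_gt0.
apply/matrixP => i j; rewrite !mxE (bigD1 (i, j)) //= !rmorphM /= mulrAC.
congr (_ * _); rewrite -[X in _ * X]divq_num_den mulrC divfK //.
by rewrite intr_eq0 denq_eq0.
Qed.

Lemma intmx_ratr p q (Z : 'M[int]_(p, q)) :
  map_mx ratr (intmx rat Z) = intmx R Z.
Proof. by apply/matrixP => i j; rewrite !mxE ratr_int. Qed.

(** A simplicial cone is defined by the nonnegativity of the coordinates along
    its generators and the equations of its span; for integral generators
    these functionals are rational, and their denominators can be cleared. *)
Lemma cone_of_halfspaces k (V : 'M[int]_(n, k)) :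
  row_free (intmx R V)^T -> exists us, cone_of (intmx R V) = halfspaces us.
Proof.
rewrite -{1}intmx_ratr map_trmx row_free_map => fV.
pose L := (pinvmx (intmx rat V)^T)^T.
have LV : L *m intmx rat V = 1%:M.
  by rewrite -[RHS]trmx1 -(mulmxVp fV) trmx_mul trmxK.
have [d [LI [d0 LE]]] := intmx_common_denominator L.
have [e [KI [e0 KE]]] := intmx_common_denominator (1%:M - intmx rat V *m L).
pose LR : 'M[R]_(k, n) := map_mx ratr L.
have LVR : LR *m intmx R V = 1%:M.
  by rewrite -intmx_ratr -map_mxM LV map_mx1.
have LRE : d%:~R *: LR = intmx R LI.
  by rewrite -intmx_ratr -LE map_mxZ /= rmorph_int.
have KRE : e%:~R *: (1%:M - intmx R V *m LR) = intmx R KI.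
  by rewrite -(intmx_ratr KI) -KE map_mxZ /= rmorph_int map_mxB map_mxM map_mx1
    intmx_ratr.
exists ([seq row i LI | i <- enum 'I_k] ++
        [seq row i KI | i <- enum 'I_n] ++ [seq - row i KI | i <- enum 'I_n]).
have rowE l (Z : 'M[int]_(l, n)) i (x : 'cV[R]_n) :
    (intmx R (row i Z) *m x) 0 0 = (intmx R Z *m x) i 0.
  by rewrite map_row -row_mul mxE.
apply/seteqP; split=> [_ [c c0 ->] u|x Hx].
  rewrite !mem_cat => /or3P[] /mapP[i _ ->].
  - rewrite rowE -LRE -scalemxAl mulmxA LVR mul1mx mxE mulr_ge0 //.
    by rewrite ler0z ltW.
  - rewrite rowE -KRE -scalemxAl mulmxBl mul1mx -mulmxA (mulmxA LR) LVR mul1mx.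
    by rewrite subrr scaler0 mxE.
  - rewrite map_mxN mulNmx mxE rowE -KRE -scalemxAl mulmxBl mul1mx -mulmxA.
    by rewrite (mulmxA LR) LVR mul1mx subrr scaler0 mxE oppr0.
exists (LR *m x) => [i|].
  have /Hx : row i LI \in [seq row i LI | i <- enum 'I_k] ++
        [seq row i KI | i <- enum 'I_n] ++ [seq - row i KI | i <- enum 'I_n].
    by rewrite mem_cat (map_f (fun i => row i LI)) ?mem_enum.
  rewrite rowE -LRE -scalemxAl mxE pmulr_rge0 //.
  by rewrite ltr0z.
apply/eqP; rewrite -subr_eq0 mulmxA -[X in X - _]mul1mx -mulmxBl.
have er0 : e%:~R != 0 :> R by rewrite intr_eq0 gt_eqF.
rewrite -(inj_eq (scalerI er0)) scaler0 scalemxAl KRE; apply/eqP/colP => i.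
rewrite [RHS]mxE; apply/eqP; rewrite eq_le -(rowE _ KI i); apply/andP; split.
  rewrite -oppr_ge0.
  have /Hx : - row i KI \in [seq row i LI | i <- enum 'I_k] ++
        [seq row i KI | i <- enum 'I_n] ++ [seq - row i KI | i <- enum 'I_n].
    by rewrite !mem_cat (map_f (fun i => - row i KI)) ?mem_enum ?orbT.
  by rewrite map_mxN mulNmx mxE.
apply: Hx; rewrite !mem_cat (map_f (fun i => row i KI)) ?mem_enum ?orbT //.
Qed.
End Cones.

(** * Simplicial fans and their ray generators *)

Lemma row_free_trP (F : fieldType) n k (V : 'M[F]_(n, k)) :
  row_free V^T <-> exists L : 'M[F]_(k, n), L *m V = 1%:M.
Proof.
split=> [/row_freeP[B VB]|[L LV]].
  by exists B^T; rewrite -[V]trmxK -trmx_mul VB trmx1.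
by apply/row_freeP; exists L^T; rewrite -trmx_mul LV trmx1.
Qed.

(** With the convention d / 0 = 0, the scale 1 / (1 + sum_i d_i / c_i) works. *)
Lemma exists_small_scale (R : realFieldType) (I : finType) (c d : I -> R) :
    (forall i, 0 <= c i) -> (forall i, 0 <= d i) ->
    (forall i, c i = 0 -> d i = 0) ->
  exists2 e, 0 < e & forall i, e * d i <= c i.
Proof.
move=> c0 d0 cd; pose K := 1 + \sum_i d i / c i.
have dc0 i : 0 <= d i / c i by rewrite divr_ge0.
have K0 : 0 < K by rewrite ltr_pwDl // sumr_ge0.
exists K^-1 => [|i]; first by rewrite invr_gt0.
rewrite mulrC ler_pdivrMr //.
have [ci|ci] := eqVneq (c i) 0; first by rewrite ci mul0r cd.
rewrite -ler_pdivrMl ?lt_def ?ci ?c0 // mulrC /K (bigD1 i) //=.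
by rewrite addrCA lerDl addr_ge0 // sumr_ge0.
Qed.

Section FanBasics.
Variables (R : realType) (n : nat).
Implicit Types (s t : set 'cV[R]_n) (x y : 'cV[R]_n).
Implicit Types (Sigma : set (set 'cV[R]_n)).

Lemma cone_of_closed k (V : 'M[R]_(n, k)) : cone_closed (cone_of V).
Proof. by rewrite cone_of_gen; apply: gen_cone_closed. Qed.

Lemma cone_of_col k (V : 'M[R]_(n, k)) j : cone_of V (col j V).
Proof. by rewrite cone_of_gen; apply: (gen_cone_gen (fun j => col j V)). Qed.

Lemma is_cone_closed s : is_cone s -> cone_closed s.
Proof. by move=> [[k [V ->]] _]; apply: cone_of_closed. Qed.

Lemma mul_row_col_sum k (V : 'M[R]_(n, k)) (u : 'rV[R]_n) (c : 'cV[R]_k) :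
  (u *m (V *m c)) 0 0 = \sum_j c j 0 * (u *m V) 0 j.
Proof. by rewrite mulmxA mxE; apply: eq_bigr => j _; rewrite mulrC. Qed.

(** A functional that is nonnegative on a cone and vanishes at a point of it
    vanishes on all generators that occur in this point. *)
Lemma cone_of_face_support k (V : 'M[R]_(n, k)) (u : 'rV[R]_n) (c : 'cV[R]_k) :
    (forall x, cone_of V x -> 0 <= (u *m x) 0 0) -> (forall j, 0 <= c j 0) ->
    (u *m (V *m c)) 0 0 = 0 -> forall j, c j 0 * (u *m V) 0 j = 0.
Proof.
move=> u0 c0; rewrite mul_row_col_sum => uc0 j.
apply: (psumr_eq0P _ uc0) => // i _; rewrite mulr_ge0 //.
by have := u0 _ (cone_of_col V i); rewrite colE mulmxA -colE mxE.
Qed.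

(** The smallest face containing x is spanned by the generators that occur in x.
    It is also the set of directions along which one can move backwards from x
    inside the cone, a description in which the generators do not occur. *)
Lemma minimal_face s x : simplicial_cone s -> s x ->
  exists t, [/\ is_face t s, t x
    & forall y, t y <-> s y /\ exists2 e : R, 0 < e & s (x - e *: y)].
Proof.
move=> [k [V [/row_free_trP[L LV] ->]]] [c c0 xE].
pose u : 'rV[R]_n := (\row_j (c j 0 == 0)%:R) *m L.
have uV : u *m V = \row_j (c j 0 == 0)%:R by rewrite -mulmxA LV mulmx1.
have uE (d : 'cV_k) : (u *m (V *m d)) 0 0 = \sum_j d j 0 * (c j 0 == 0)%:R.
  by rewrite mul_row_col_sum uV; apply: eq_bigr => j _; rewrite mxE.
have u0 y : cone_of V y -> 0 <= (u *m y) 0 0.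
  by move=> [d d0 ->]; rewrite uE sumr_ge0 // => j _; rewrite mulr_ge0.
exists [set y | cone_of V y /\ (u *m y) 0 0 = 0]; split.
- by exists u.
- rewrite xE; split; first by exists c.
  rewrite uE big1 // => j _.
  by have [->|] := eqVneq (c j 0) 0; rewrite ?mul0r ?mulr0.
- move=> y; split=> [[[d d0 ->] ud]|[[d d0 yE] [e e0 [f f0 fE]]]].
    split; first by exists d.
    have [|||e e0 He] := @exists_small_scale _ _ (fun j => c j 0) (fun j => d j 0).
    + exact: c0.
    + exact: d0.
    + move=> j cj; have := cone_of_face_support u0 d0 ud j.
      by rewrite uV mxE cj eqxx mulr1.
    exists e => //; exists (c - e *: d).
      by move=> j; rewrite !mxE subr_ge0.
    by rewrite xE mulmxBr -scalemxAr.
  split; first by exists d.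
  move: fE; rewrite xE yE => /(congr1 (mulmx L)).
  rewrite mulmxBr -scalemxAr !mulmxA LV !mul1mx => fE.
  rewrite -mulmxA uE big1 // => j _; case: eqP => [cj|]; last by rewrite mulr0.
  have := f0 j; rewrite -fE !mxE cj sub0r oppr_ge0 pmulr_rle0 // => dj.
  by rewrite mulr1; apply/eqP; rewrite eq_le dj d0.
Qed.

Definition ray_of (v : 'cV[R]_n) : set 'cV[R]_n :=
  [set c *: v | c in [set c : R | 0 <= c]].

Lemma is_ray_eq t v : is_ray t -> t v -> v != 0 -> t = ray_of v.
Proof.
move=> [w w0 ->] [a /= a0 <-] v0.
have ap : 0 < a.
  by rewrite lt_def a0 andbT; apply: contraNneq v0 => ->; rewrite scale0r.
apply/seteqP; split=> [_ [c /= c0 <-]|_ [c /= c0 <-]].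
  exists (c / a); first by rewrite /= divr_ge0.
  by rewrite scalerA divfK // gt_eqF.
by exists (c * a); rewrite /= ?mulr_ge0 // scalerA.
Qed.

Lemma intmx_eq0 p q (Z : 'M[int]_(p, q)) : (intmx R Z == 0) = (Z == 0).
Proof.
apply/eqP/eqP => [Z0|->]; last by rewrite map_mx0.
by apply/matrixP => i j; have /matrixP/(_ i j) := Z0; rewrite !mxE => /eqP;
  rewrite intr_eq0 => /eqP.
Qed.

(** Among the nonzero lattice points of a rational ray there is one of smallest
    norm, so the default value in the choice of the generator does not occur. *)
Lemma ray_generatorP t : rational_polyhedral t -> is_ray t ->
  ray_generator t != 0 /\ t (intmx R (ray_generator t)).
Proof.
move=> [k [V tE]] [v v0 tv].
pose P (w : 'cV[int]_n) := w != 0 /\ t (intmx R w).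
have [w0 [w00 tw0]] : exists w, P w.
  have [c c0 vE] : cone_of (intmx R V) v.
    by rewrite -tE tv; exists 1; rewrite /= ?ler01 ?scale1r.
  have [j Vj] : exists j, col j V != 0.
    apply: contrapT => noj; move/eqP: v0; apply.
    rewrite vE mulmx_col_sum big1 // => j _.
    have -> : col j (intmx R V) = 0.
      apply/eqP; rewrite -map_col intmx_eq0; apply/negPn/negP => Vj.
      by apply: noj; exists j.
    by rewrite scaler0.
  by exists (col j V); split=> //; rewrite map_col tE; apply: cone_of_col.
pose norm2 (w : 'cV[int]_n) := \sum_i w i 0 ^+ 2.
have norm2_ge0 w : 0 <= norm2 w by apply: sumr_ge0 => i _; apply: sqr_ge0.
have exn : exists m : nat, `[< exists2 w, P w & norm2 w = m%:Z >].
  exists `|norm2 w0|%N; apply/asboolP; exists w0 => //.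
  by rewrite gez0_abs.
have [m /asboolP[w [w1 tw] wm] min] := ex_minnP exn.
suff /(@xgetPex _ 0) [g0 tg _] : exists w : 'cV[int]_n,
    [/\ w != 0, t (intmx R w) & forall w' : 'cV[int]_n, w' != 0 ->
       t (intmx R w') -> \sum_i w i 0 ^+ 2 <= \sum_i w' i 0 ^+ 2] by [].
exists w; split=> // w' w'0 tw'; rewrite -/(norm2 w) wm -/(norm2 w').
have := min `|norm2 w'|%N; rewrite -lez_nat gez0_abs //; apply.
by apply/asboolP; exists w' => //; rewrite gez0_abs.
Qed.

Definition generator_matrix Sigma k (tau : 'I_k -> rays Sigma) : 'M[int]_(n, k) :=
  \matrix_(i, j) ray_generator (val (tau j)) i 0.

Lemma col_generator_matrix Sigma k (tau : 'I_k -> rays Sigma) j :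
  col j (generator_matrix tau) = ray_generator (val (tau j)).
Proof. by apply/colP => i; rewrite !mxE. Qed.

Lemma rays_in Sigma (tau : rays Sigma) : Sigma (val tau) /\ is_ray (val tau).
Proof. exact: set_mem (valP tau). Qed.

Lemma fan_ray_generatorP Sigma (tau : rays Sigma) : is_fan Sigma ->
  ray_generator (val tau) != 0 /\ val tau (intmx R (ray_generator (val tau))).
Proof.
move=> [_ cS _ _]; have [St rt] := rays_in tau.
by apply: ray_generatorP => //; have [] := cS _ St.
Qed.

(** The half-lines spanned by the real generators of a simplicial cone are faces
    of it, so they belong to the fan and in particular are rational.  Hence one
    may rescale the generators to the primitive lattice points of these rays.
    Conversely a ray of the fan inside s is a face of s, and a one-dimensional
    face contains a generator. *)
Lemma simplicial_generators Sigma s : is_fan Sigma -> simplicial_cone s ->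
    Sigma s ->
  exists k (tau : 'I_k -> rays Sigma),
    [/\ row_free (intmx R (generator_matrix tau))^T,
        s = cone_of (intmx R (generator_matrix tau)),
        forall i, val (tau i) `<=` s
      & forall rho : rays Sigma, val rho `<=` s -> exists i, rho = tau i].
Proof.
move=> fS [k [V [/row_free_trP[L LV] sE]]] Ss.
have [_ cS faS inS] := fS.
have VL (c : 'cV[R]_k) : L *m (V *m c) = c by rewrite mulmxA LV mul1mx.
have v0 j : col j V != 0.
  apply/eqP => /(congr1 (mulmx L)); rewrite colE VL mulmx0 => /colP/(_ j).
  by rewrite !mxE !eqxx => /eqP; rewrite oner_eq0.
have sv j : s (col j V) by rewrite sE; apply: cone_of_col.
have tS j : rays Sigma (ray_of (col j V)).
  split; last by exists (col j V).
  apply: (faS s) => //.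
  pose u : 'rV[R]_n := (\row_i (i != j)%:R) *m L.
  have uE (d : 'cV_k) : (u *m (V *m d)) 0 0 = \sum_(i | i != j) d i 0.
    rewrite -mulmxA VL mxE [RHS]big_mkcond; apply: eq_bigr => i _; rewrite mxE.
    by case: ifP; rewrite ?mul1r ?mul0r.
  exists u => [x|].
    by rewrite sE => -[d d0 ->]; rewrite uE sumr_ge0.
  apply/seteqP; split=> [_ [c /= c0 <-]|x /=].
    rewrite colE scalemxAr; split.
      rewrite sE; exists (c *: delta_mx j 0) => // i.
      by rewrite !mxE mulr_ge0 // ler0n.
    by rewrite uE big1 // => i ij; rewrite !mxE (negbTE ij) mulr0.
  rewrite sE => -[[d d0 ->]]; rewrite uE => /psumr_eq0P d00.
  exists (d j 0); first exact: d0.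
  rewrite mulmx_col_sum (bigD1 j) //= big1 ?addr0 // => i ij.
  by rewrite d00 ?scale0r.
pose tau j : rays Sigma := exist (fun t => t \in rays Sigma) _ (mem_set (tS j)).
have valtau j : val (tau j) = ray_of (col j V) by [].
have /fin_all_exists[a aE] : forall j, exists a : R,
    0 < a /\ intmx R (ray_generator (val (tau j))) = a *: col j V.
  move=> j; have [g0 [a /= a0 gE]] := fan_ray_generatorP (tau j) fS.
  exists a; split=> //; rewrite lt_def a0 andbT.
  apply: contraNneq g0 => a00; move/eqP: gE.
  by rewrite a00 scale0r eq_sym intmx_eq0.
have gE : intmx R (generator_matrix tau) = V *m diag_mx (\row_j a j).
  apply/matrixP => i j; rewrite mul_mx_diag !mxE mulrC.
  by have [_ /colP/(_ i)] := aE j; rewrite !mxE.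
have da : diag_mx (\row_j (a j)^-1) *m diag_mx (\row_j a j) = 1%:M :> 'M[R]_k.
  rewrite mulmx_diag -diag_const_mx; congr diag_mx; apply/rowP => j.
  by rewrite !mxE mulVf // gt_eqF //; have [] := aE j.
exists k, tau; split.
- apply/row_free_trP; exists (diag_mx (\row_j (a j)^-1) *m L).
  by rewrite gE mulmxA -(mulmxA _ L) LV mulmx1.
- rewrite gE sE; apply/seteqP; split=> [_ [c c0 ->]|_ [c c0 ->]].
    exists (diag_mx (\row_j (a j)^-1) *m c).
      move=> j; rewrite mul_diag_mx !mxE mulr_ge0 // invr_ge0 ltW //.
      by have [] := aE j.
    by rewrite -mulmxA (mulmxA (diag_mx _)) (diag_mxC (\row_j a j)) da mul1mx.
  exists (diag_mx (\row_j a j) *m c); last by rewrite mulmxA.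
  by move=> j; rewrite mul_diag_mx !mxE mulr_ge0 // ltW //; have [] := aE j.
- move=> j _ [c /= c0 <-]; have [_ _ sZ] := is_cone_closed (cS _ Ss).
  exact: sZ.
- move=> rho rs; have [Sr rr] := rays_in rho.
  have [[u u0 uE] _] := inS _ _ Ss Sr.
  rewrite (setIidr rs) in uE.
  have [w w0 wE] := rr.
  have rw : val rho w by rewrite wE; exists 1; rewrite /= ?ler01 ?scale1r.
  have [sw uw] : s w /\ (u *m w) 0 0 = 0 by move: rw; rewrite uE.
  move: sw; rewrite {1}sE => -[c c0 wV]; rewrite sE in u0.
  rewrite wV in uw; have cu := cone_of_face_support u0 c0 uw.
  have [j cj] : exists j, c j 0 != 0.
    apply: contrapT => noj; move/eqP: w0; apply; rewrite wV.
    rewrite (_ : c = 0) ?mulmx0 //; apply/colP => j; rewrite mxE; apply/eqP.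
    by apply/negPn/negP => cj; apply: noj; exists j.
  exists j; apply/val_inj; rewrite valtau; apply: is_ray_eq => //.
  rewrite uE; split; first exact: sv.
  have /eqP := cu j; rewrite mulf_eq0 (negbTE cj) /= => /eqP <-.
  by rewrite colE mulmxA -colE mxE.
Qed.
End FanBasics.

(** * Resolution of a monomial map and the pull back of divisors *)

Section Pullback.
Variables (R : realType) (n : nat).
Implicit Types (s t : set 'cV[R]_n) (x y : 'cV[R]_n).
Implicit Types (Sigma : set (set 'cV[R]_n)) (A : 'M[int]_n).

Definition cap_preimage A s t : set 'cV[R]_n :=
  s `&` [set x | t (intmx R A *m x)].

Lemma is_face_cap_preimage A s t s0 t0 : is_face s0 s -> is_face t0 t ->
  is_face (cap_preimage A s0 t0) (cap_preimage A s t).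
Proof.
move=> [u u0 ->] [w w0 ->]; exists (u + w *m intmx R A).
  move=> x [sx tx]; rewrite mulmxDl mxE addr_ge0 ?u0 //.
  by rewrite -mulmxA w0.
apply/seteqP; split=> x /=.
  by move=> [[sx ux] [tx wx]]; rewrite mulmxDl -mulmxA mxE ux wx addr0.
move=> [[sx tx]]; rewrite mulmxDl -mulmxA mxE => /eqP.
by rewrite paddr_eq0 ?u0 ?w0 // => /andP[/eqP ux /eqP wx].
Qed.

(** The sum x0 of those generators of the intersection that lie in F is a
    relative interior point of F.  The minimal faces of s and t around x0 and
    A x0 cut out F: a functional that is nonnegative on the intersection and
    vanishes at x0 vanishes along every direction in which one can move from x0
    both forwards and backwards. *)
Lemma face_cap_preimage A s t F :
    simplicial_cone s -> simplicial_cone t ->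
    rational_polyhedral (cap_preimage A s t) -> is_face F (cap_preimage A s t) ->
  exists s0 t0, [/\ is_face s0 s, is_face t0 t & F = cap_preimage A s0 t0].
Proof.
move=> ss st [k [V CV]] [u u0 FE]; set C := cap_preimage A s t in CV u0 FE.
have clos s' : simplicial_cone s' -> cone_closed s'.
  by move=> [k' [V' [_ ->]]]; apply: cone_of_closed.
have {clos} [[_ sD sZ] [_ tD tZ]] := (clos _ ss, clos _ st).
(* the sum of the generators of the intersection that lie in F *)
pose c0 : 'cV[R]_k := \col_j ((u *m intmx R V) 0 j == 0)%:R.
have c00 j : 0 <= c0 j 0 by rewrite mxE ler0n.
pose x0 := intmx R V *m c0.
have Cx0 : C x0 by rewrite CV; exists c0.
have [s0 [s0s s0x s0P]] := minimal_face ss Cx0.1.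
have [t0 [t0t t0x t0P]] := minimal_face st Cx0.2.
have ux0 : (u *m x0) 0 0 = 0.
  rewrite mul_row_col_sum big1 // => j _; rewrite mxE.
  by case: eqP => [->|]; rewrite ?mulr0 ?mul0r.
exists s0, t0; split=> //; rewrite FE; apply/seteqP; split=> y /=.
  move=> [Cy uy]; have [sy ty] := Cy.
  have [e e0 Ce] : exists2 e : R, 0 < e & C (x0 - e *: y).
    move: Cy uy; rewrite CV => -[d d0 ->] ud.
    have cud := cone_of_face_support (V := intmx R V) _ d0 ud.
    have [|||e e0 He] := @exists_small_scale _ _ (fun j => c0 j 0) (fun j => d j 0).
    - exact: c00.
    - exact: d0.
    - move=> j; rewrite mxE => /eqP; rewrite pnatr_eq0 eqb0 => uV.
      have := cud _ j; rewrite -CV => /(_ u0)/eqP.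
      by rewrite mulf_eq0 (negbTE uV) orbF => /eqP.
    exists e => //; exists (c0 - e *: d) => [j|]; last first.
      by rewrite mulmxBr -scalemxAr.
    by rewrite mxE [X in _ + X]mxE [X in _ - X]mxE subr_ge0.
  have [se te] := Ce; split; first by apply/s0P; split=> //; exists e.
  apply/t0P; split=> //; exists e => //.
  by move: te; rewrite /= mulmxBr -scalemxAr.
move=> [/s0P[sy [e1 e10 se1]] /t0P[ty [e2 e20 te2]]].
have Cy : C y by [].
split=> //; apply/eqP; rewrite eq_le u0 // andbT.
pose e := Num.min e1 e2.
have e0 : 0 < e by rewrite lt_min e10.
have shrink (z w : 'cV[R]_n) (f : R) : 0 < f -> e <= f ->
    z - e *: w = (1 - e / f) *: z + (e / f) *: (z - f *: w).
  move=> f0 ef; rewrite scalerBr scalerA divfK ?gt_eqF // addrA.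
  by rewrite -scalerDl subrK scale1r.
have ef01 (f : R) : 0 < f -> e <= f -> 0 <= 1 - e / f /\ 0 <= e / f.
  move=> f0 ef; rewrite subr_ge0 ler_pdivrMr // mul1r ef divr_ge0 //; exact: ltW.
have [le1 le2] : e <= e1 /\ e <= e2 by rewrite !ge_min !lexx orbT.
have Ce : C (x0 - e *: y).
  split.
    rewrite (shrink _ _ e1) //; have [h1 h2] := ef01 _ e10 le1.
    by apply: sD; apply: sZ => //; exact: Cx0.1.
  rewrite /= mulmxBr -scalemxAr (shrink _ _ e2) //.
  have [h1 h2] := ef01 _ e20 le2.
  by apply: tD; apply: tZ => //; exact: Cx0.2.
have -> : (u *m y) 0 0 = - e^-1 * (u *m (x0 - e *: y)) 0 0.
  rewrite mulmxBr -scalemxAr; move: ux0; move: (u *m x0) (u *m y) => p q p0.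
  by rewrite !mxE p0 sub0r mulrNN mulKf // gt_eqF.
by rewrite mulNr oppr_le0 mulr_ge0 ?u0 // invr_ge0 ltW.
Qed.

Lemma halfspaces_preimage A us :
  [set x : 'cV[R]_n | halfspaces us (intmx R A *m x)] =
  halfspaces [seq u *m A | u <- us].
Proof.
apply/seteqP; split=> x /= Hx.
  by move=> _ /mapP[u uus ->]; rewrite map_mxM -mulmxA; apply: Hx.
by move=> u uus; rewrite mulmxA -map_mxM; apply: Hx; apply: map_f.
Qed.

(** The cones of points of s whose image lies in t, for s and t in the fan, form
    a refinement on which A maps cones into cones. *)
Lemma resolution_exists A Sigma : toric_birational_model Sigma ->
  exists Sigma', refines Sigma' Sigma /\ maps_cones A Sigma' Sigma.
Proof.
move=> [fS comp simp]; have [fin cS faS inS] := fS.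
pose C (st : set 'cV[R]_n * set 'cV[R]_n) := cap_preimage A st.1 st.2.
exists [set C st | st in Sigma `*` Sigma].
have polC s t : Sigma s -> Sigma t -> rational_polyhedral (cap_preimage A s t).
  move=> Ss St; have [ps _] := cS _ Ss.
  have [k [tau [fV tE _ _]]] := simplicial_generators fS (simp _ St) St.
  have [us usE] := cone_of_halfspaces fV.
  rewrite /cap_preimage tE usE halfspaces_preimage.
  exact: rational_polyhedral_halfspaces.
split; last first.
  move=> _ [[s t] [/= Ss St] <-]; exists t => // _ [x [_ tx] <-]; exact: tx.
split; last 2 first.
- rewrite comp -subTset => x _.
  have : Defs.support Sigma x by rewrite comp.
  move=> [s Ss sx].
  have : Defs.support Sigma (intmx R A *m x) by rewrite comp.
  move=> [t St tx]; exists (C (s, t)) => //; by exists (s, t).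
- by move=> _ [[s t] [/= Ss St] <-]; exists s => // x [].
split.
- exact/finite_image/finite_setX.
- move=> _ [[s t] [/= Ss St] <-]; split; first exact: polC.
  by move=> x [sx _] [sNx _]; have [_] := cS _ Ss; apply.
- move=> _ F [[s t] [/= Ss St] <-] FC.
  have [s0 [t0 [s0s t0t ->]]] :=
    face_cap_preimage (simp _ Ss) (simp _ St) (polC _ _ Ss St) FC.
  by exists (s0, t0) => //; split; [apply: faS s0s|apply: faS t0t].
- move=> _ _ [[s t] [/= Ss St] <-] [[s' t'] [/= Ss' St'] <-].
  have -> : C (s, t) `&` C (s', t') = cap_preimage A (s `&` s') (t `&` t').
    apply/seteqP; split=> x; first by move=> [[? ?] [? ?]].
    by move=> [[? ?] [? ?]].
  have [f1 f2] := inS _ _ Ss Ss'; have [f3 f4] := inS _ _ St St'.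
  by split; apply: is_face_cap_preimage.
Qed.

(** A cone s' of the refinement that contains a generator of the ray t lies in a
    cone s of the fan, and t is a face of s.  The functional cutting t out of s
    cuts t out of s' as well. *)
Lemma rays_refinement Sigma Sigma' : is_fan Sigma -> complete_fan Sigma ->
  refines Sigma' Sigma -> rays Sigma `<=` rays Sigma'.
Proof.
move=> [_ cS _ inS] comp [[_ cS' faS' _] sup ref] t [St rt]; split=> //.
have [v v0 tE] := rt.
have tv : t v by rewrite tE; exists 1; rewrite /= ?ler01 ?scale1r.
have : Defs.support Sigma' v by rewrite sup comp.
move=> [s' Ss' s'v]; have [s Ss ss'] := ref _ Ss'.
have [[u u0 uE] _] := inS _ _ Ss St.
have tE' : s `&` t = t.
  apply/setIidr; rewrite tE => _ [c /= c0 <-].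
  by have [_ _ sZ] := is_cone_closed (cS _ Ss); apply/sZ/ss'.
rewrite tE' in uE; apply: (faS' s') => //.
exists u => [x s'x|]; first by apply/u0/ss'.
apply/seteqP; split=> [|x [s'x ux]]; last by rewrite uE; split=> //; apply: ss'.
rewrite {1}tE => _ [c /= c0 <-].
have [_ _ sZ] := is_cone_closed (cS' _ Ss').
split; first exact: sZ.
have : t (c *: v) by rewrite tE; exists c.
by rewrite uE => -[].
Qed.

Lemma local_equation_eval Sigma (D : TDiv Sigma) s m k (tau : 'I_k -> rays Sigma)
    (w : 'cV[int]_n) (c : 'cV[R]_k) :
    local_equation D s m -> (forall i, val (tau i) `<=` s) ->
    intmx R w = intmx R (generator_matrix tau) *m c ->
  ratr ((m *m intmx rat w) 0 0) = \sum_i c i 0 * ratr (D (tau i)).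
Proof.
move=> Dm taus wE.
have -> : ratr ((m *m intmx rat w) 0 0) =
    (map_mx ratr (m *m intmx rat (generator_matrix tau)) *m c) 0 0.
  by rewrite map_mxM intmx_ratr -mulmxA -wE -intmx_ratr -map_mxM [RHS]mxE.
rewrite mxE; apply: eq_bigr => j _; rewrite mulrC (Dm _ (taus j)); congr (_ * _).
by rewrite -col_generator_matrix map_col colE !mulmxA -colE mxE [in RHS]mxE.
Qed.

(** Two cones meet in a common face, whose generators are rays of the fan; both
    local equations take there the values prescribed by D.  Thus D defines a
    function on the whole space that is linear on each cone. *)
Lemma local_equation_unique Sigma (D : TDiv Sigma) s1 s2 m1 m2 (w : 'cV[int]_n) :
    is_fan Sigma -> simplicial_fan Sigma -> Sigma s1 -> Sigma s2 ->
    s1 (intmx R w) -> s2 (intmx R w) ->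
    local_equation D s1 m1 -> local_equation D s2 m2 ->
  (m1 *m intmx rat w) 0 0 = (m2 *m intmx rat w) 0 0.
Proof.
move=> fS simp Ss1 Ss2 s1w s2w D1 D2; have [_ _ faS inS] := fS.
have Ss : Sigma (s1 `&` s2) by apply: (faS s1) => //; have [] := inS _ _ Ss1 Ss2.
have [k [tau [_ sE tau12 _]]] := simplicial_generators fS (simp _ Ss) Ss.
have [c c0 wE] : cone_of (intmx R (generator_matrix tau)) (intmx R w).
  by rewrite -sE.
apply: (@fmorph_inj _ _ (ratr : rat -> R)) => /=.
rewrite (local_equation_eval D1 _ wE) ?(local_equation_eval D2 _ wE) //.
  by move=> i x /tau12[].
by move=> i x /tau12[].
Qed.

Lemma local_equation_exists Sigma (D : TDiv Sigma) s :
    is_fan Sigma -> simplicial_fan Sigma -> Sigma s ->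
  exists m, local_equation D s m.
Proof.
move=> fS simp Ss.
have [k [tau [fV _ _ tauP]]] := simplicial_generators fS (simp _ Ss) Ss.
rewrite -intmx_ratr map_trmx row_free_map in fV.
have [L LV] := (row_free_trP _).1 fV.
exists ((\row_j D (tau j)) *m L) => rho /tauP[j ->].
rewrite -col_generator_matrix map_col colE !mulmxA -(mulmxA _ L) LV mulmx1.
by rewrite -colE !mxE.
Qed.

(** Evaluation of the piecewise linear function of D at the image under A of the
    ray generator.  Refinements keep the rays of the fan, so the push forward
    only forgets coefficients, and on the cone tau itself the pulled back
    divisor has the local equation m A. *)
Lemma pullbackE A Sigma (D : TDiv Sigma) (tau : rays Sigma) s m :
    toric_birational_model Sigma -> Sigma s ->
    s (intmx R (A *m ray_generator (val tau))) -> local_equation D s m ->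
  pullback A D tau = (m *m intmx rat (A *m ray_generator (val tau))) 0 0.
Proof.
move=> model Ss sA Dm; have [fS comp simp] := model.
rewrite /pullback; set Sigma' := resolution A Sigma.
have [ref _] : refines Sigma' Sigma /\ maps_cones A Sigma' Sigma.
  exact: (xgetPex set0 (resolution_exists A model)).
have fS' : is_fan Sigma' by case: ref.
pose good (E : TDiv Sigma') := forall s' s m, Sigma' s' -> Sigma s ->
  [set intmx R A *m x | x in s'] `<=` s -> local_equation D s m ->
  local_equation E s' (m *m intmx rat A).
(* the value at a ray does not depend on the cone into which A maps it *)
have exE : exists E, good E.
  pose P (tau' : rays Sigma') q := exists s m, [/\ Sigma s,
    s (intmx R (A *m ray_generator (val tau'))), local_equation D s m &
    q = (m *m intmx rat (A *m ray_generator (val tau'))) 0 0].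
  exists (fun tau' => xget 0 [set q | P tau' q]) => s' s1 m1 Ss' Ss1 As1 Dm1 tau' ts'.
  have [_ tg] := fan_ray_generatorP tau' fS'.
  have s1A : s1 (intmx R (A *m ray_generator (val tau'))).
    by rewrite map_mxM; apply: As1; exists (intmx R (ray_generator (val tau')));
      [apply: ts'|].
  rewrite -mulmxA -map_mxM; case: xgetP => [q _ [s2 [m2 [Ss2 s2A Dm2 ->]]]|].
    exact: local_equation_unique Dm2 Dm1.
  by move=> /(_ ((m1 *m intmx rat (A *m ray_generator (val tau'))) 0 0))[];
    exists s1, m1.
have gE : good (morphism_pullback A D) := xgetPex _ exE.
rewrite /Defs.pushforward; have rt := rays_in tau.
have rt' : rays Sigma' (val tau) by apply: (rays_refinement fS comp ref).
case: insubP => [tau' _ tE|]; last by rewrite (mem_set rt').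
have As : [set intmx R A *m x | x in val tau] `<=` s.
  move=> _ [x tx <-]; have [g0 tg] := fan_ray_generatorP tau fS.
  have tauE := is_ray_eq rt.2 tg.
  rewrite intmx_eq0 in tauE; rewrite (tauE g0) in tx.
  case: tx => c /= c0 <-; rewrite -scalemxAr -map_mxM.
  by have [_ cS _ _] := fS; have [_ _ sZ] := is_cone_closed (cS _ Ss); apply: sZ.
have tS' : Sigma' (val tau) by case: rt'.
have := gE _ _ _ tS' Ss As Dm tau'; rewrite tE => -> //.
by rewrite -mulmxA -map_mxM.
Qed.
End Pullback.

(** * A basis of lattice vectors around the dominant direction *)

Lemma bernoulli_ineq (R : realDomainType) (h : R) k :
  0 <= h -> 1 + h *+ k <= (1 + h) ^+ k.
Proof.
move=> h0; elim: k => [|k IH]; first by rewrite mulr0n addr0 expr0.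
rewrite exprS; have := ler_wpM2l (_ : 0 <= 1 + h) IH.
rewrite addr_ge0 // => /(_ isT); apply: le_trans.
rewrite mulrDr mulr1 mulrDl mul1r -!addrA lerD2l mulrS lerD2l lerDl.
by rewrite mulr_ge0 // mulrn_wge0.
Qed.

(** The ratio (s / r)^k exceeds any bound by the inequality of Bernoulli. *)
Lemma geometric_domination (R : realType) (r s d e : R) :
    0 < r -> r < s -> 0 < e ->
  exists K, forall k, (K <= k)%N -> d * r ^+ k < e * s ^+ k.
Proof.
move=> r0 rs e0; pose h := s / r - 1.
have h0 : 0 < h by rewrite subr_gt0 ltr_pdivlMr // mul1r.
exists (Num.bound (`|d| / (e * h))) => k Kk.
have : `|d| / (e * h) < k%:R.
  apply: lt_le_trans (archi_boundP _) _; first by rewrite divr_ge0 // ltW // mulr_gt0.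
  by rewrite ler_nat.
rewrite ltr_pdivrMr ?mulr_gt0 // => dk.
have sE : s = r * (1 + h) by rewrite /h addrC subrK mulrC divfK // gt_eqF.
rewrite sE exprMn mulrCA mulrC ltr_pM2l ?exprn_gt0 //.
apply: le_lt_trans (ler_norm d) _.
apply: lt_le_trans dk _; rewrite mulrCA ler_pM2l //.
apply: le_trans (bernoulli_ineq k (ltW h0)).
by rewrite mulr_natl lerDr.
Qed.

(** Take the columns W_j = a e_j + p with p_i the integral part of M v_i.  For
    large M they all have almost the direction of v, so xi, which is 1 at v, is
    positive on them; and v lies inside the simplex because a = n + 1 exceeds
    the total rounding error, which is at most n. *)
Lemma integral_simplex_around (R : realType) n (v : 'cV[R]_n) (xi : 'rV[R]_n) :
    (forall i, 0 < v i 0) -> xi *m v = 1%:M ->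
  exists W : 'M[int]_n, [/\ intmx R W \in unitmx,
    forall i, 0 < (invmx (intmx R W) *m v) i 0
    & forall j, 0 < (xi *m intmx R W) 0 j].
Proof.
move=> v0 xiv.
pose a : R := n.+1%:R; have a0 : 0 < a by rewrite ltr0n.
pose X := \sum_j `|xi 0 j|.
have X0 : 0 <= X by apply: sumr_ge0.
pose M := Num.bound ((a + 1) * X).
have MX : (a + 1) * X < M%:R.
  by apply: archi_boundP; rewrite mulr_ge0 // addr_ge0 ?ler01 // ltW.
pose p i : int := Num.floor (M%:R * v i 0).
have pv i : (p i)%:~R <= M%:R * v i 0 < (p i)%:~R + 1.
  by have := floor_itv (M%:R * v i 0); rewrite intrD.
pose P : R := \sum_i (p i)%:~R; pose S := \sum_i v i 0.
have S0 : 0 <= S by apply: sumr_ge0 => i _; apply: ltW.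
have P0 : 0 <= P.
  apply: sumr_ge0 => i _; rewrite ler0z floor_ge0 mulr_ge0 // ltW //.
have PMS : M%:R * S - n%:R <= P.
  rewrite /P /S mulr_sumr lerBlDr.
  have -> : n%:R = \sum_(i < n) 1 :> R by rewrite sumr_const card_ord.
  by rewrite -big_split /=; apply: ler_sum => i _; have /andP[_ /ltW] := pv i.
pose W : 'M[int]_n := \matrix_(i, j) (n.+1%:Z *+ (i == j) + p i).
pose pR : 'cV[R]_n := \col_i (p i)%:~R.
pose one : 'rV[R]_n := const_mx 1.
have WE : intmx R W = a%:M + pR *m one.
  apply/matrixP => i j; rewrite !mxE big_ord1 !mxE mulr1 intrD; congr (_ + _).
  by case: (i == j); rewrite ?mulr1n ?mulr0n.
have oneE (w : 'cV[R]_n) : one *m w = (\sum_i w i 0)%:M.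
  by apply/matrixP => i j; rewrite !ord1 !mxE eqxx; apply: eq_bigr => k _;
    rewrite mxE mul1r.
have onep : one *m pR = P%:M.
  by rewrite oneE; congr _%:M; apply: eq_bigr => i _; rewrite mxE.
pose U := a^-1 *: (1%:M - (a + P)^-1 *: (pR *m one)).
have aP : 0 < a + P by rewrite ltr_pwDl.
have UW : U *m intmx R W = 1%:M.
  rewrite WE /U -scalemxAl mulmxBl mul1mx -scalemxAl mulmxDr.
  have -> : pR *m one *m (pR *m one) = P *: (pR *m one).
    by rewrite -mulmxA (mulmxA one) onep mul_scalar_mx scalemxAr.
  rewrite mul_mx_scalar -scalerDl scalerA mulVf ?gt_eqF // scale1r addrK.
  by rewrite scale_scalar_mx mulVf // gt_eqF.
have Wu : intmx R W \in unitmx by have [] := mulmx1_unit UW.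
exists W; split=> //.
  have -> : invmx (intmx R W) = U.
    by rewrite -[U]mulmx1 -(mulmxV Wu) mulmxA UW mul1mx.
  move=> i; rewrite /U -scalemxAl mxE mulr_gt0 ?invr_gt0 //.
  rewrite mulmxBl mul1mx -scalemxAl -mulmxA oneE mul_mx_scalar.
  rewrite mxE [X in _ + X]mxE [X in _ - X]mxE [X in _ - _ * X]mxE.
  rewrite [pR i 0]mxE -/S subr_gt0 mulrC ltr_pdivrMr //.
  have /andP[pl _] := pv i.
  apply: le_lt_trans (_ : _ <= M%:R * v i 0 * S) _.
    by rewrite mulrC ler_wpM2r.
  have -> : M%:R * v i 0 * S = v i 0 * (M%:R * S) by ring.
  rewrite ltr_pM2l // -ltrBlDl; apply: lt_le_trans PMS.
  by rewrite ltrD2l ltrN2 ltr_nat.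
move=> j; rewrite WE mulmxDr mul_mx_scalar mulmxA [xi *m pR]mx11_scalar.
rewrite mul_scalar_mx mxE [X in _ + X]mxE [X in X + _]mxE [one 0 j]mxE mulr1.
have xp : M%:R - X <= (xi *m pR) 0 0.
  have -> : M%:R = \sum_i xi 0 i * (M%:R * v i 0).
    have /matrixP/(_ 0 0) := xiv; rewrite !mxE eqxx => xv.
    rewrite -[LHS]mulr1 -[X in _ * X]xv mulr_sumr; apply: eq_bigr => i _; ring.
  rewrite lerBlDr mxE /X -big_split /=; apply: ler_sum => i _; rewrite mxE.
  rewrite -lerBlDl -mulrBr (le_trans (ler_norm _)) // normrM.
  rewrite ler_piMr // ger0_norm; have /andP[h1 h2] := pv i; lra.
have xj : - X <= xi 0 j.
  rewrite lerNl (le_trans (ler_norm _)) // normrN /X (bigD1 j) //= lerDl.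
  exact: sumr_ge0.
have : a * - X <= a * xi 0 j by rewrite ler_pM2l.
by rewrite mulrN; lra.
Qed.

(** After a change of sign of v and xi some coordinate v_j is positive, and an
    integral shear adds a large multiple of v_j to the others. *)
Lemma integral_simplex_near (R : realType) n (v : 'cV[R]_n) (xi : 'rV[R]_n) :
    xi *m v = 1%:M ->
  exists W : 'M[int]_n, intmx R W \in unitmx /\
    forall i j, 0 < (invmx (intmx R W) *m v) i 0 * (xi *m intmx R W) 0 j.
Proof.
move=> xiv.
wlog [j vj] : v xi xiv / exists j, 0 < v j 0.
  move=> H; have [j vj] : exists j, v j 0 != 0.
    apply: contrapT => noj; have /matrixP/(_ 0 0) := xiv.
    rewrite !mxE eqxx big1 => [/eqP|i _]; first by rewrite eq_sym oner_eq0.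
    have [->|vi] := eqVneq (v i 0) 0; first by rewrite mulr0.
    by case: noj; exists i.
  move: vj; rewrite neq_lt => /orP[vj|vj]; last by apply: H => //; exists j.
  have [] := H (- v) (- xi); first by rewrite mulNmx mulmxN opprK.
    by exists j; rewrite mxE oppr_gt0.
  move=> W [Wu WP]; exists W; split=> // i k; have := WP i k.
  by rewrite mulmxN mulNmx !mxE mulrNN.
pose t := Num.bound (\sum_i `|v i 0| / v j 0).
have tv i : 0 < v i 0 + t%:R * v j 0.
  have : `|v i 0| / v j 0 < t%:R.
    apply: le_lt_trans (archi_boundP _); last first.
      by apply: sumr_ge0 => k _; rewrite divr_ge0 // ltW.
    rewrite (bigD1 i) //= lerDl; apply: sumr_ge0 => k _.
    by rewrite divr_ge0 // ltW.
  rewrite ltr_pdivrMr // => h; have := ler_norm (- v i 0); rewrite normrN; lra.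
pose N : 'M[int]_n := (\col_i (i != j)%:R) *m delta_mx 0 j.
have NN : N *m N = 0.
  rewrite /N mulmxA -(mulmxA _ (delta_mx 0 j)) -rowE.
  by rewrite [row j _]mx11_scalar !mxE eqxx mul_mx_scalar scale0r mul0mx.
pose T : 'M[int]_n := 1%:M + t%:Z *: N; pose T' : 'M[int]_n := 1%:M - t%:Z *: N.
have T'T : T' *m T = 1%:M.
  rewrite mulmxBl mul1mx mulmxDr mulmx1 -scalemxAr -scalemxAl NN !scaler0 addr0.
  by rewrite addrK.
pose TR := intmx R T; pose TR' := intmx R T'.
have T'TR : TR' *m TR = 1%:M by rewrite -map_mxM T'T map_mx1.
have [T'u Tu] := mulmx1_unit T'TR.
have [] := @integral_simplex_around R n (TR *m v) (xi *m TR').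
- move=> i; rewrite /TR map_mxD map_mx1 map_mxZ mulmxDl mul1mx -scalemxAl.
  rewrite map_mxM -mulmxA map_delta_mx -rowE mxE [X in _ + X]mxE.
  rewrite [row j v]mx11_scalar mul_mx_scalar !mxE.
  case: (i =P j) => [->|_]; last by rewrite /= mulr1; exact: tv.
  by rewrite /= mulr0 mulr0 addr0.
- by rewrite mulmxA -(mulmxA xi) T'TR mulmx1.
move=> W [Wu UW xW]; exists (T' *m W); rewrite map_mxM unitmx_mul T'u Wu.
split=> // i k.
have -> : invmx (TR' *m intmx R W) = invmx (intmx R W) *m TR.
  have u : TR' *m intmx R W \in unitmx by rewrite unitmx_mul T'u.
  apply: (can_inj (mulmxK u)); rewrite mulVmx // mulmxA -(mulmxA _ TR).
  by rewrite (mulmx1C T'TR) mulmx1 mulVmx.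
by rewrite -(mulmxA _ TR) (mulmxA xi); apply: mulr_gt0; [exact: UW|exact: xW].
Qed.

(** * Orthant fans and stable models *)

(** The image of each ray generator falls into one of the two invariant cones s
    and stays there.  On such an s the pull back of a divisor with local
    equation m has the local equation m B, so pulling back k times evaluates
    m B^k, which is what the pull back by B^k does. *)
Lemma stable_of_invariant_cones (R : realType) n (B : 'M[int]_n)
    (Sigma : set (set 'cV[R]_n)) (s1 s2 : set 'cV[R]_n) :
    toric_birational_model Sigma -> Sigma s1 -> Sigma s2 ->
    (forall x, s1 x -> s1 (intmx R B *m x)) ->
    (forall x, s2 x -> s2 (intmx R B *m x)) ->
    (forall tau : rays Sigma, let y := intmx R (B *m ray_generator (val tau)) in
       s1 y \/ s2 y) ->
  strongly_algebraically_stable B Sigma.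
Proof.
move=> model S1 S2 B1 B2 rB k k0 D _; have [fS _ simp] := model.
case: k k0 => // k _; elim: k D => [|k IH] D //.
rewrite iterSr -IH; apply/funext => tau.
have {rB} [s [Ss Bs sB]] : exists s, [/\ Sigma s,
    forall x, s x -> s (intmx R B *m x)
    & s (intmx R (B *m ray_generator (val tau)))].
  by case: (rB tau) => ?; [exists s1|exists s2].
have sBk j : s (intmx R (B ^+ j.+1 *m ray_generator (val tau))).
  elim: j => [|j IHj]; first by rewrite expr1.
  by rewrite exprS -mulmxE -mulmxA map_mxM; apply: Bs.
have [m Dm] := local_equation_exists D fS simp Ss.
have D'm : local_equation (pullback B D) s (m *m intmx rat B).
  move=> rho rs; rewrite (pullbackE model Ss _ Dm); last first.
    rewrite map_mxM; apply/Bs/rs.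
    by have [] := fan_ray_generatorP rho fS.
  by rewrite map_mxM mulmxA.
rewrite (pullbackE model Ss (sBk k.+1) Dm) (pullbackE model Ss (sBk k) D'm).
by rewrite -[in RHS]mulmxA -map_mxM [in RHS]mulmxA mulmxE -exprS.
Qed.

(** The columns of W are a basis of the space; the cones spanned by subsets of
    this basis up to signs form the fan of a finite quotient of (P^1)^n. *)
Section OrthantFan.
Variables (R : realType) (n : nat) (W : 'M[int]_n).
Hypothesis Wu : intmx R W \in unitmx.
Implicit Types (f g h : {ffun 'I_n -> option bool}) (x : 'cV[R]_n).
Let WR := intmx R W.
Let U := invmx WR.

(** The sign 0 is encoded by [None] and the sign (-1)^b by [Some b]. *)
Definition sign_value (o : option bool) : int :=
  if o is Some b then (-1) ^+ b else 0.

(** An orthant in the basis W.  The vanishing signs give null generators, which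
    saves the enumeration of the remaining indices. *)
Definition orthant (f : {ffun 'I_n -> option bool}) : set 'cV[R]_n :=
  cone_of (intmx R (W *m diag_mx (\row_i sign_value (f i)))).

Definition orthant_fan : set (set 'cV[R]_n) := range orthant.

Definition has_sign (o : option bool) (a : R) : Prop :=
  match o with
  | None => a = 0
  | Some false => 0 <= a
  | Some true => a <= 0
  end.

Let UW : U *m WR = 1%:M := mulVmx Wu.
Let WU : WR *m U = 1%:M := mulmxV Wu.

Lemma orthantP f x : orthant f x <-> forall i, has_sign (f i) ((U *m x) i 0).
Proof.
have E : intmx R (W *m diag_mx (\row_i sign_value (f i))) =
    WR *m diag_mx (\row_i (sign_value (f i))%:~R).
  by rewrite map_mxM map_diag_mx; congr (_ *m diag_mx _); apply/rowP => i;
    rewrite !mxE.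
rewrite /orthant E; split=> [[c c0 ->] i|H].
  rewrite !mulmxA UW mul1mx mul_diag_mx !mxE.
  case: (f i) => [[]|] /=; rewrite ?mul0r // ?expr1 ?mulN1r ?oppr_le0 ?c0 //.
  by rewrite expr0 mul1r.
exists (\col_i ((sign_value (f i))%:~R * (U *m x) i 0)) => [i|].
  rewrite mxE; have := H i; case: (f i) => [[]|] /=; rewrite ?mul0r //.
    by rewrite expr1 mulN1r oppr_ge0.
  by rewrite expr0 mul1r.
rewrite -[x in LHS]mul1mx -WU -!mulmxA; congr (_ *m _).
apply/colP => i; rewrite mul_diag_mx [RHS]mxE [X in X * _]mxE [X in _ * X]mxE.
rewrite mulrA; have := H i; case: (f i) => [[]|] /=.
- by rewrite expr1 mulrNN !mul1r.
- by rewrite expr0 !mul1r.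
- by move=> ->; rewrite mulr0.
Qed.

Lemma orthant_axis f i (a : R) : has_sign (f i) a ->
  orthant f (a *: col i WR).
Proof.
move=> fa; apply/orthantP => j; rewrite -scalemxAr colE mulmxA UW mul1mx !mxE.
case: (j =P i) => [->|_]; first by rewrite eqxx mulr1.
by rewrite mulr0; case: (f j) => [[]|] /=.
Qed.

Lemma orthant_pairing (u : 'rV[R]_n) x :
  (u *m x) 0 0 = \sum_i (u *m WR) 0 i * (U *m x) i 0.
Proof. by rewrite -[x in LHS]mul1mx -WU -mulmxA mulmxA mxE. Qed.

Lemma orthant_subface (f h : {ffun 'I_n -> option bool}) :
  (forall i, h i = f i \/ h i = None) -> is_face (orthant h) (orthant f).
Proof.
move=> hf; pose u : 'rV[R]_n :=
  (\row_i (if h i == None then (sign_value (f i))%:~R else 0)) *m U.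
have uE x : (u *m x) 0 0 = \sum_i
   (if h i == None then (sign_value (f i))%:~R else 0) * (U *m x) i 0.
  by rewrite -mulmxA mxE; apply: eq_bigr => i _; rewrite mxE.
have term_ge0 x i : orthant f x ->
    0 <= (if h i == None then (sign_value (f i))%:~R else 0) * (U *m x) i 0.
  move=> /orthantP/(_ i); case: ifP => _; last by rewrite mul0r.
  by case: (f i) => [[]|] /=; rewrite ?expr1 ?expr0 ?mulN1r ?mul1r ?mul0r
    ?oppr_ge0.
exists u => [x fx|].
  by rewrite uE sumr_ge0 // => i _; apply: term_ge0.
apply/seteqP; split=> [x /orthantP hx|x [fx]].
  split.
    apply/orthantP => i; have := hx i; have [->|->] := hf i => //= ->.
    by case: (f i) => [[]|] /=.
  rewrite uE big1 // => i _; have := hx i.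
  by case: (h i) => [b|] /=; rewrite ?mul0r // => ->; rewrite mulr0.
rewrite uE => /psumr_eq0P H; apply/orthantP => i.
have := H (fun i _ => term_ge0 x i fx) i isT.
have /orthantP/(_ i) := fx.
have [->|hi] := hf i; first by [].
rewrite hi eqxx; case: (f i) => [[]|] //= _.
  by rewrite expr1 mulN1r => /eqP; rewrite oppr_eq0 => /eqP.
by rewrite expr0 mul1r.
Qed.

Lemma face_orthant f F : is_face F (orthant f) -> orthant_fan F.
Proof.
move=> [u u0 ->].
pose h : {ffun 'I_n -> option bool} :=
  [ffun i => if (u *m WR) 0 i == 0 then f i else None].
exists h => //; apply/seteqP; split=> [x /orthantP hx|x [fx ux]].
  split.
    apply/orthantP => i; have := hx i; rewrite ffunE; case: ifP => //= _ ->.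
    by case: (f i) => [[]|] /=.
  rewrite orthant_pairing big1 // => i _; have := hx i; rewrite ffunE.
  by case: eqP => [->|_ /= ->]; rewrite ?mul0r ?mulr0.
have := ux; rewrite orthant_pairing => /psumr_eq0P H.
apply/orthantP => i; have fxi := (orthantP f x).1 fx i.
rewrite ffunE; case: ifP => // uWi.
suff /H/(_ i isT)/eqP : forall j, true -> 0 <= (u *m WR) 0 j * (U *m x) j 0.
  by rewrite mulf_eq0 uWi => /eqP.
move=> j _; have := u0 _ (orthant_axis ((orthantP f x).1 fx j)).
by rewrite -scalemxAr colE mulmxA -colE mxE [X in _ * X]mxE mulrC.
Qed.

Lemma orthant_cap f g : exists h, [/\ orthant f `&` orthant g = orthant h,
  forall i, h i = f i \/ h i = None & forall i, h i = g i \/ h i = None].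
Proof.
exists [ffun i => if f i == g i then f i else None]; split.
- apply/seteqP; split=> [x [/orthantP fx /orthantP gx]|x /orthantP hx].
    apply/orthantP => i; have := fx i; have := gx i; rewrite ffunE.
    case: (f i) (g i) => [[]|] [[]|] //=; move=> h1 h2; apply/eqP; rewrite eq_le;
    by rewrite ?h1 ?h2 ?lexx.
  split; apply/orthantP => i; have := hx i; rewrite ffunE;
    by case: (f i) (g i) => [[]|] [[]|] //= ->.
- by move=> i; rewrite ffunE; case: eqP; [left|right].
- by move=> i; rewrite ffunE; case: eqP => [->|]; [left|right].
Qed.

(** The nonzero generators are indexed by the support of f. *)
Lemma orthant_simplicial f : simplicial_cone (orthant f).
Proof.
pose J := [pred i | f i != None].
pose V : 'M[R]_(n, #|J|) :=
  \matrix_(i, j) ((sign_value (f (enum_val j)))%:~R * WR i (enum_val j)).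
have colV j : col j V = (sign_value (f (enum_val j)))%:~R *: col (enum_val j) WR.
  by apply/colP => i; rewrite !mxE.
exists #|J|, V; split.
  pose L : 'M[R]_(#|J|, n) :=
    \matrix_(j, i) ((sign_value (f (enum_val j)))%:~R * U (enum_val j) i).
  apply/row_free_trP; exists L; apply/matrixP => j l; rewrite mxE.
  have -> : \sum_i L j i * V i l =
      (sign_value (f (enum_val j)))%:~R * (sign_value (f (enum_val l)))%:~R *
      (U *m WR) (enum_val j) (enum_val l).
    by rewrite [in RHS]mxE mulr_sumr; apply: eq_bigr => i _; rewrite !mxE; ring.
  rewrite UW !mxE (inj_eq enum_val_inj); case: eqP => [->|_]; last by rewrite mulr0.
  have := enum_valP l; rewrite inE; case: (f _) => [[]|] //= _.
    by rewrite expr1 mulrNN !mulr1.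
  by rewrite expr0 !mulr1.
apply/seteqP; split=> [x fx|_ [c c0 ->]]; last first.
  rewrite mulmx_col_sum; apply: cone_closed_sum => [|j|j]; first exact: cone_of_closed.
    exact: c0.
  rewrite colV; apply: orthant_axis.
  by case: (f _) => [[]|] /=; rewrite ?expr1 ?expr0 ?ler0N1 ?ler01 ?lerN10.
have fxi := (orthantP f x).1 fx.
exists (\col_j ((sign_value (f (enum_val j)))%:~R * (U *m x) (enum_val j) 0)).
  move=> j; rewrite mxE; have := fxi (enum_val j); have := enum_valP j; rewrite inE.
  by case: (f _) => [[]|] //= _; rewrite ?expr1 ?expr0 ?mul1r ?mulN1r ?oppr_ge0.
rewrite mulmx_col_sum -[LHS]mul1mx -WU -mulmxA mulmx_col_sum.
rewrite (bigID J) /= [X in _ + X]big1 ?addr0; last first.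
  by move=> i; have := fxi i; case: (f i) => //= ->; rewrite scale0r.
rewrite (_ : \sum_(i | J i) _ =
    \sum_(j < #|J|) (U *m x) (enum_val j) 0 *: col (enum_val j) WR); last first.
  exact: (big_enum_val (A := J) (fun i => (U *m x) i 0 *: col i WR)).
apply: eq_bigr => j _; rewrite colV scalerA; congr (_ *: _).
rewrite [X in X * _]mxE.
have := enum_valP j; rewrite inE; case: (f (enum_val j)) => [[]|] //= _.
  by rewrite expr1 mulN1r mulrN1 opprK.
by rewrite expr0 mul1r mulr1.
Qed.

Lemma orthant_fan_model : toric_birational_model orthant_fan.
Proof.
split.
- split.
  + exact/finite_image/finite_finset.
  + move=> _ [f _ <-]; split.
      by exists n, (W *m diag_mx (\row_i sign_value (f i))).
    move=> x /orthantP fx /orthantP fNx.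
    rewrite -[x]mul1mx -WU -mulmxA (_ : U *m x = 0) ?mulmx0 //; apply/colP => i.
    have := fx i; have := fNx i; rewrite mulmxN !mxE.
    by case: (f i) => [[]|] //=; rewrite ?oppr_ge0 ?oppr_le0 => h1 h2;
      apply/eqP; rewrite eq_le h1 h2.
  + by move=> _ F [f _ <-]; apply: face_orthant.
  + move=> _ _ [f _ <-] [g _ <-]; have [h [-> hf hg]] := orthant_cap f g.
    by split; apply: orthant_subface.
- rewrite /complete_fan -subTset => x _.
  pose f : {ffun 'I_n -> option bool} := [ffun i => Some ((U *m x) i 0 < 0)].
  exists (orthant f); first by exists f.
  apply/orthantP => i; rewrite ffunE; case: (ltP ((U *m x) i 0) 0) => //= h.
  exact: ltW.
- by move=> _ [f _ <-]; apply: orthant_simplicial.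
Qed.

Lemma orthant_ray_axis f x : is_ray (orthant f) -> orthant f x ->
  exists i a, x = a *: col i WR.
Proof.
move=> rf fx; have [v v0 fE] := rf.
have fxi := (orthantP f x).1 fx.
have [i fi] : exists i, f i <> None.
  apply: contrapT => nof; move/eqP: v0; apply.
  have /orthantP fv : orthant f v by rewrite fE; exists 1; rewrite /= ?scale1r.
  rewrite -[v]mul1mx -WU -mulmxA (_ : U *m v = 0) ?mulmx0 //; apply/colP => i.
  have := fv i; rewrite [RHS]mxE; case fi : (f i) => [b|] //= _.
  by case: nof; exists i; rewrite fi.
exists i, ((U *m x) i 0).
have wi : orthant f ((sign_value (f i))%:~R *: col i WR).
  by apply: orthant_axis; case: (f i) => [[]|] /=;
    rewrite ?expr1 ?expr0 ?lerN10 ?ler01.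
have Ucol (a : R) j : U *m (a *: col j WR) = a *: delta_mx j 0.
  by rewrite -scalemxAr colE mulmxA UW mul1mx.
have wi0 : (sign_value (f i))%:~R *: col i WR != 0.
  apply/eqP => /(congr1 (mulmx U)); rewrite Ucol mulmx0 => /colP/(_ i).
  rewrite !mxE !eqxx mulr1; case: (f i) fi => [[]|] //= _ /eqP.
    by rewrite expr1 oppr_eq0 oner_eq0.
  by rewrite expr0 oner_eq0.
move: fx; rewrite (is_ray_eq rf wi wi0) => -[a _ <-].
rewrite scalerA; congr (_ *: _); rewrite Ucol !mxE !eqxx mulr1 //.
Qed.
End OrthantFan.
Arguments orthant_fan R {n} W _.
Arguments orthant R {n} W f _.

Section Eigenvalues.
Variables (R : realType) (n : nat) (A : 'M[int]_n).

Lemma intmx_complex : intmx R[i] A = map_mx (real_complex R) (intmx R A).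
Proof. by apply/matrixP => i j; rewrite !mxE rmorph_int. Qed.

Lemma eigenvalue_conj (mu : R[i]) :
  eigenvalue (intmx R[i] A) mu -> eigenvalue (intmx R[i] A) mu^*%C.
Proof.
have E : map_mx (@conjc R) (intmx R[i] A) = intmx R[i] A.
  by apply/matrixP => i j; rewrite !mxE rmorph_int.
by rewrite -[X in _ -> eigenvalue X _]E eigenvalue_map.
Qed.

Lemma eigenvalue_neq0 (mu : R[i]) :
  \det A != 0 -> eigenvalue (intmx R[i] A) mu -> mu != 0.
Proof.
move=> dA /eigenvalueP[y yA y0]; apply: contraNneq y0 => mu0.
have Au : intmx R[i] A \in unitmx.
  by rewrite unitmxE det_map_mx unitfE intr_eq0.
by apply/eqP; rewrite -[y](mulmxK Au) yA mu0 scale0r mul0mx.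
Qed.

Lemma nonmaximal_eigenvalue (lambda mu : R[i]) :
    maximal_modulus_eigenvalue A lambda -> eigenvalue (intmx R[i] A) mu ->
    ~ maximal_modulus_eigenvalue A mu ->
  `|mu| < `|lambda|.
Proof.
move=> [el lmax] emu nmax; rewrite lt_neqAle lmax // andbT.
by apply/eqP => E; apply: nmax; split=> // nu /lmax; rewrite E.
Qed.
End Eigenvalues.

Section PositiveAction.
Variables (R : realType) (n : nat) (W B : 'M[int]_n).
Hypothesis Wu : intmx R W \in unitmx.
Let G := invmx (intmx R W) *m intmx R B *m intmx R W.
Hypothesis G0 : forall i j, 0 < G i j.

(** A positive matrix maps the positive orthant into itself and its opposite
    likewise, and it sends each half-axis into one of the two. *)
Lemma orthant_fan_stable : strongly_algebraically_stable B (orthant_fan R W).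
Proof.
pose s b := orthant R W [ffun=> Some b].
have UB (x : 'cV[R]_n) : invmx (intmx R W) *m (intmx R B *m x) =
    G *m (invmx (intmx R W) *m x).
  by rewrite /G -!mulmxA (mulmxA (intmx R W)) mulmxV // mul1mx.
have sP b (x : 'cV[R]_n) : s b x <->
    forall i, 0 <= (-1) ^+ b * (invmx (intmx R W) *m x) i 0.
  split=> [/(orthantP Wu) H i|H]; last apply/(orthantP Wu) => i.
    by have := H i; rewrite ffunE; case: b {H} => /=;
      rewrite ?expr1 ?expr0 ?mulN1r ?mul1r ?oppr_ge0.
  by have := H i; rewrite ffunE; case: b {H} => /=;
    rewrite ?expr1 ?expr0 ?mulN1r ?mul1r ?oppr_ge0.
have sB b x : s b x -> s b (intmx R B *m x).
  move=> /sP sx; apply/sP => i; rewrite UB mxE mulr_sumr sumr_ge0 // => j _.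
  by rewrite mulrCA mulr_ge0 // ltW.
apply: (stable_of_invariant_cones (s1 := s false) (s2 := s true)).
- exact: orthant_fan_model.
- by eexists.
- by eexists.
- exact: sB.
- exact: sB.
move=> tau y; have [fS _ _] := orthant_fan_model Wu.
have [_ tg] := fan_ray_generatorP tau fS.
have [[f _ fE] rt] := rays_in tau.
have [i [a gE]] : exists i a, intmx R (ray_generator (val tau)) =
    a *: col i (intmx R W) by apply: (orthant_ray_axis Wu (f := f)); rewrite fE.
have Uy j : (invmx (intmx R W) *m y) j 0 = a * G j i.
  rewrite /y map_mxM UB gE -scalemxAr (colE i) (mulmxA _ (intmx R W)) mulVmx //.
  by rewrite mul1mx -scalemxAr -colE !mxE.
case: (leP 0 a) => a0; [left|right]; apply/sP => j; rewrite Uy.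
  by rewrite expr0 mul1r mulr_ge0 // ltW.
by rewrite expr1 mulN1r oppr_ge0 mulr_le0_ge0 // ltW.
Qed.
End PositiveAction.

(** The conjugate of lambda is again of maximal modulus, so lambda is real.  In a
    basis W around the dominant direction the matrix of A^k is lambda^k times
    the positive matrix (W^-1 v)(xi W), up to an exponentially smaller error;
    so it is positive for large even k. *)
Lemma stable_model_of_dominant_eigenvalue (R : realType) (n : nat)
    (A : 'M[int]_n) (lambda : R[i]) :
    \det A != 0 ->
    (forall mu : R[i], maximal_modulus_eigenvalue A mu <-> mu = lambda) ->
    algebraic_multiplicity A lambda = 1%N ->
  lambda \is Num.real /\
  exists (Sigma : set (set 'cV[R]_n)) (k : nat),
    [/\ toric_birational_model Sigma, (0 < k)%N
      & strongly_algebraically_stable (A ^+ k) Sigma].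
Proof.
move=> dA maxl mul; have lmax := (maxl lambda).2 erefl.
case: n A dA maxl mul lmax => [|n] A dA maxl mul lmax.
  have [/eigenvalueP[y _]] := lmax; by rewrite [y]thinmx0 eqxx.
have lreal : lambda \is Num.real.
  have : maximal_modulus_eigenvalue A lambda^*%C.
    have [el lm] := lmax; split; first exact: eigenvalue_conj.
    by move=> mu /lm; rewrite normcJ.
  move/maxl; case: (lambda) => a b [] /eqP.
  by rewrite complex_real eqNr.
split=> //; set l := complex.Re lambda.
have lE : lambda = l%:C%C by rewrite RRe_real.
have el : eigenvalue (intmx R A) l.
  have [el _] := lmax; move: el.
  by rewrite intmx_complex lE eigenvalue_map.
have l0 : l != 0.
  have [el' _] := lmax; have := eigenvalue_neq0 dA el'.
  by apply: contraNneq => l0; rewrite lE l0.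
have [||v [xi [r [/andP[r0 rl] xiv [d dP]]]]] :=
  @dominant_projection R n (intmx R A) l l0 el.
- by rewrite -intmx_complex -lE.
- move=> mu; rewrite -intmx_complex -lE => emu mul'.
  apply: (nonmaximal_eigenvalue lmax emu) => /maxl mul''.
  by rewrite mul'' eqxx in mul'.
have [W [Wu WP]] := integral_simplex_near xiv.
set U := invmx (intmx R W) in WP.
pose q i j := (U *m v) i 0 * (xi *m intmx R W) 0 j.
have [|||e e0 eq] := @exists_small_scale R ('I_n.+1 * 'I_n.+1)%type
    (fun p => q p.1 p.2) (fun=> 1).
- by move=> p; apply/ltW/WP.
- by [].
- by move=> p p0; have := WP p.1 p.2; rewrite -/(q _ _) p0 ltxx.
have [d' d'P] : geom_bounded r (fun k => U *m (intmx R A ^+ k -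
    l ^+ k *: (v *m xi)) *m intmx R W).
  by apply/geom_bounded_mulmxr/geom_bounded_mulmxl; exists d.
have [K KP] := geometric_domination d' r0 rl e0.
(* an even exponent makes l ^+ k positive whatever the sign of l *)
exists (orthant_fan R W), (K.+1).*2; split=> //; first exact: orthant_fan_model.
set k := (K.+1).*2; have Kk : (K <= k)%N.
  by rewrite /k -addnn (leq_trans (leqnSn K)) ?leq_addr.
have lk : `|l| ^+ k = l ^+ k.
  by rewrite -normrX ger0_norm // /k -muln2 exprM sqr_ge0.
apply: (orthant_fan_stable Wu) => i j.
have -> : intmx R (A ^+ k) = intmx R A ^+ k by rewrite rmorphXn.
have -> : U *m intmx R A ^+ k *m intmx R W =
   l ^+ k *: (U *m v *m (xi *m intmx R W)) +
   U *m (intmx R A ^+ k - l ^+ k *: (v *m xi)) *m intmx R W.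
  rewrite mulmxBr mulmxBl -scalemxAr -scalemxAl !mulmxA addrC subrK //.
rewrite mxE [X in X + _]mxE [X in _ * X + _]mxE big_ord1 -/(q i j).
have := d'P k i j; rewrite ler_norml => /andP[h _].
have := KP k Kk; rewrite lk => h2.
have : e * l ^+ k <= l ^+ k * q i j.
  rewrite mulrC ler_wpM2l -?lk ?exprn_ge0 //.
  by have := eq (i, j); rewrite mulr1.
by lra.
Qed.

(** * Cones along the orbit of a ray *)

Section StableImages.
Variables (R : realType) (n : nat) (A : 'M[int]_n) (Sigma : set (set 'cV[R]_n)).
Hypothesis model : toric_birational_model Sigma.

(** The minimal face around x: one can move backwards from x along each of its
    generators, so all coordinates of x are positive. *)
Lemma cone_with_interior_point (x : 'cV[R]_n) :
  exists k (tau : 'I_k -> rays Sigma) (c : 'cV[R]_k),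
    let s := cone_of (intmx R (generator_matrix tau)) in
    [/\ Sigma s, row_free (intmx R (generator_matrix tau))^T,
        forall i, val (tau i) `<=` s, forall i, 0 < c i 0
      & x = intmx R (generator_matrix tau) *m c].
Proof.
have [fS comp simp] := model; have [_ cS faS _] := fS.
have : Defs.support Sigma x by rewrite comp.
move=> [s0 Ss0 s0x]; have [s [ss0 sx sP]] := minimal_face (simp _ Ss0) s0x.
have Ss : Sigma s := faS _ _ Ss0 ss0.
have [k [tau [fV sE taus _]]] := simplicial_generators fS (simp _ Ss) Ss.
have := sx; rewrite {1}sE => -[c c0 xE].
exists k, tau, c; rewrite /= -sE; split=> // i.
rewrite lt_def c0 andbT.
have [L LV] := (row_free_trP _).1 fV.
have gs : s (col i (intmx R (generator_matrix tau))).
  by rewrite sE; apply: cone_of_col.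
have [s0g [e e0 s0xg]] := (sP _).1 gs.
have [_ _ s0Z] := is_cone_closed (cS _ Ss0).
have : s (x - e *: col i (intmx R (generator_matrix tau))).
  apply/sP; split=> //; exists 1; rewrite ?ltr01 //.
  by rewrite scale1r opprB addrCA subrr addr0; apply: s0Z => //; apply: ltW.
rewrite {1}sE => -[d d0 /(congr1 (mulmx L))].
rewrite xE mulmxBr -scalemxAr colE !mulmxA LV !mul1mx => /colP/(_ i).
rewrite !mxE !eqxx mulr1 => E; apply: lt0r_neq0.
by have := d0 i; rewrite -E subr_ge0; apply: lt_le_trans.
Qed.

Lemma pullback_eval (D : TDiv Sigma) (rho : rays Sigma) k
    (tau : 'I_k -> rays Sigma) (d : 'cV[R]_k) :
    let s := cone_of (intmx R (generator_matrix tau)) in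
    Sigma s -> (forall i, val (tau i) `<=` s) -> (forall i, 0 <= d i 0) ->
    intmx R (A *m ray_generator (val rho)) =
      intmx R (generator_matrix tau) *m d ->
  ratr (pullback A D rho) = \sum_i d i 0 * ratr (D (tau i)).
Proof.
move=> s Ss taus d0 dE; have [fS _ simp] := model.
have [m Dm] := local_equation_exists D fS simp Ss.
have sA : s (intmx R (A *m ray_generator (val rho))) by rewrite dE; exists d.
by rewrite (pullbackE model Ss sA Dm) (local_equation_eval Dm taus dE).
Qed.

Lemma pullback_ge0 (D : TDiv Sigma) (rho : rays Sigma) :
  (forall tau, 0 <= D tau) -> 0 <= pullback A D rho.
Proof.
move=> D0.
have [k [tau [d [Ss _ taus d0 dE]]]] :=
  cone_with_interior_point (intmx R (A *m ray_generator (val rho))).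
rewrite -(ler0q R) (pullback_eval D Ss taus _ dE) => [|i]; last exact: ltW.
by apply: sumr_ge0 => i _; rewrite mulr_ge0 ?ler0q // ltW.
Qed.

(** The combinatorial core of stability: if the orbit of a ray meets the interior
    of s and its next point lies in s', then A maps all of s into s'.  Let D be
    the prime divisor of a ray outside s'.  Its piecewise linear function
    vanishes at the next point of the orbit, and stability makes this value a
    combination with positive coefficients of the values at the images of the
    generators of s, which are nonnegative, hence zero.  So these images have no
    component along rays outside s'. *)
Lemma stable_maps_cone (rho : rays Sigma) j k (tau : 'I_k -> rays Sigma)
    (c : 'cV[R]_k) s' :
    let s := cone_of (intmx R (generator_matrix tau)) in
    strongly_algebraically_stable A Sigma ->
    Sigma s -> (forall i, val (tau i) `<=` s) -> (forall i, 0 < c i 0) ->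
    intmx R (A ^+ j.+1 *m ray_generator (val rho)) =
      intmx R (generator_matrix tau) *m c ->
    Sigma s' -> s' (intmx R (A ^+ j.+2 *m ray_generator (val rho))) ->
  forall x, s x -> s' (intmx R A *m x).
Proof.
move=> s stab Ss taus c0 cE Ss' s'x; have [fS _ simp] := model.
have [_ cS _ _] := fS.
have s'cl := is_cone_closed (cS _ Ss').
suff s'g i : s' (intmx R (A *m ray_generator (val (tau i)))).
  move=> _ [e e0 ->]; rewrite mulmxA mulmx_col_sum.
  apply: cone_closed_sum => // i.
  by rewrite -map_mxM -map_col colE -mulmxA -colE col_generator_matrix.
have [l [sigma [d [St _ sigmat d0 dE]]]] :=
  cone_with_interior_point (intmx R (A *m ray_generator (val (tau i)))).
rewrite dE mulmx_col_sum; apply: cone_closed_sum => // [p|p]; first exact: ltW.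
rewrite -map_col col_generator_matrix.
have [/(_ _ (fan_ray_generatorP (sigma p) fS).2) //|nsub] :=
  pselect (val (sigma p) `<=` s').
pose D : TDiv Sigma := fun rho => (rho == sigma p)%:R.
have D0 rho' : 0 <= D rho' by rewrite ler0n.
have Dl : local_equation D s' 0.
  move=> rho' sub; rewrite mul0mx mxE /D; case: eqP => // E.
  by case: nsub; rewrite -E.
have QD : Q_Cartier D by move=> s1 Ss1; apply: local_equation_exists.
pose D' := pullback A D.
have [m D'm] := local_equation_exists D' fS simp Ss.
have sx : s (intmx R (A ^+ j.+1 *m ray_generator (val rho))).
  by rewrite cE; exists c => // q; apply: ltW.
(* pulling back D in j + 2 steps amounts to pulling back D' in j + 1 steps *)
have : pullback (A ^+ j.+1) D' rho = 0.
  have QD' : Q_Cartier D' by move=> s1 Ss1; apply: local_equation_exists.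
  rewrite (stab j.+1 isT D' QD') -iterSr -(stab j.+2 isT D QD).
  by rewrite (pullbackE model Ss' s'x Dl) mul0mx mxE.
rewrite (pullbackE model Ss sx D'm) => /(congr1 (@ratr R)).
rewrite (local_equation_eval D'm taus cE) rmorph0 => /psumr_eq0P sum0.
have D'0 q : 0 <= ratr (D' (tau q)) :> R by rewrite ler0q; apply: pullback_ge0.
have /eqP : c i 0 * ratr (D' (tau i)) = 0.
  by apply: sum0 => // q _; rewrite mulr_ge0 // ltW.
rewrite mulf_eq0 gt_eqF // /= (pullback_eval D St sigmat _ dE); last first.
  by move=> q; apply: ltW.
move=> /eqP/psumr_eq0P sum0'.
have /eqP : d p 0 * ratr (D (sigma p)) = 0.
  by apply: sum0' => // q _; rewrite mulr_ge0 ?ler0q // ltW.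
by rewrite mulf_eq0 gt_eqF //= /D eqxx rmorph1 oner_eq0.
Qed.

(** The minimal cones around the points of the orbit of a ray are mapped into one
    another, and there are finitely many of them. *)
Lemma stable_periodic_cone (rho : rays Sigma) :
    strongly_algebraically_stable A Sigma ->
  exists s j m, [/\ Sigma s, (0 < m)%N,
    s (intmx R (A ^+ j *m ray_generator (val rho)))
    & forall x, s x -> s (intmx R (A ^+ m) *m x)].
Proof.
move=> stab; pose x j := intmx R (A ^+ j.+1 *m ray_generator (val rho)).
have /choice[g gP] : forall j, exists s, [/\ Sigma s, s (x j) &
    forall s', Sigma s' -> s' (x j.+1) -> forall y, s y -> s' (intmx R A *m y)].
  move=> j; have [k [tau [c [Ss _ taus c0 cE]]]] := cone_with_interior_point (x j).
  exists (cone_of (intmx R (generator_matrix tau))); split=> //.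
    by rewrite cE; exists c => // i; apply: ltW.
  move=> s' Ss' s'x; exact: stable_maps_cone c0 cE Ss' s'x.
have gD j m y : g j y -> g (j + m)%N (intmx R (A ^+ m) *m y).
  elim: m j y => [|m IH] j y gy; first by rewrite addn0 expr0 map_mx1 mul1mx.
  rewrite exprS -mulmxE map_mxM -mulmxA addnS.
  have [_ _ gA] := gP (j + m)%N; have [SS xS _] := gP (j + m).+1.
  by apply: gA => //; apply: IH.
have [i [j [ij gij]]] : exists i j, (i < j)%N /\ g i = g j.
  apply: contrapT => no; have ginj : {in setT &, injective g}.
    move=> i j _ _ gE; apply/eqP; case: (ltngtP i j) => // ij; exfalso; apply: no.
      by exists i, j.
    by exists j, i.
  have [[fin _ _ _] _ _] := model.
  apply: infinite_nat; rewrite -(eq_finite_set (inj_card_eq ginj)).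
  by apply: sub_finite_set fin => _ [k _ <-]; have [] := gP k.
exists (g i), i.+1, (j - i)%N; have [Sg gx _] := gP i; split=> //.
  by rewrite subn_gt0.
by move=> y gy; rewrite gij -[X in g X](subnKC (ltnW ij)); apply: gD.
Qed.

(** The rays of a complete fan span the space. *)
Lemma ray_off_hyperplane (xi : 'rV[R[i]]_n) : xi != 0 ->
  exists rho : rays Sigma, xi *m intmx R[i] (ray_generator (val rho)) != 0.
Proof.
move=> xi0; apply: contrapT => no; move/eqP: xi0; apply.
have xix (x : 'cV[R]_n) : xi *m map_mx (real_complex R) x = 0.
  have [k [tau [c [_ _ _ _ ->]]]] := cone_with_interior_point x.
  rewrite map_mxM mulmxA (_ : xi *m _ = 0) ?mul0mx //.
  apply/rowP => i; rewrite [RHS]mxE.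
  have -> : (xi *m map_mx (real_complex R) (intmx R (generator_matrix tau))) 0 i =
      (xi *m intmx R[i] (ray_generator (val (tau i)))) 0 0.
    rewrite -col_generator_matrix map_col !mxE; apply: eq_bigr => j _.
    by rewrite !mxE rmorph_int.
  have [->|ne] := eqVneq (xi *m intmx R[i] (ray_generator (val (tau i)))) 0.
    by rewrite mxE.
  by case: no; exists (tau i).
apply/rowP => i; have := xix (delta_mx i 0); rewrite map_delta_mx -colE.
by move=> /matrixP/(_ 0 0); rewrite !mxE.
Qed.
End StableImages.

(** * Irrational rotation *)

Section Trigonometry.
Variable R : realType.
Implicit Types (a : R).

Lemma sin_eq0_int a : sin a = 0 -> exists z : int, a = z%:~R * pi.
Proof.
move=> sa; have p0 : 0 < pi :> R := pi_gt0 R.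
exists (Num.floor (a / pi)); set z := Num.floor _.
have /andP[z1 z2] := floor_itv (a / pi); rewrite -/z in z1 z2.
rewrite ler_pdivlMr // in z1; rewrite ltr_pdivrMr // intrD mulrDl mul1r in z2.
pose b := a - z%:~R * pi.
have sb : sin b = 0.
  have shift (x y : R) (m : nat) : x = y + pi *+ m -> (sin x == 0) = (sin y == 0).
    by move=> ->; rewrite (alternatingn (@sinDpi R)) mulf_eq0 signr_eq0.
  apply/eqP; rewrite /b; case: (z) => m.
    by rewrite -(shift a _ m) ?sa // pmulrn mulr_natl subrK.
  by rewrite (shift _ a m.+1) ?sa // NegzE mulrNz mulNr opprK mulr_natl.
have [b0|b0] := eqVneq b 0; first by apply/eqP; rewrite -subr_eq0 -/b b0.
have : 0 < sin b by apply: sin_gt0_pi; rewrite /b in b0 *; lra.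
by rewrite sb ltxx.
Qed.

(** As long as the cosines stay positive, 1 - cos at least doubles together
    with the angle, because 1 - cos (2 x) = 2 (1 - cos x) (1 + cos x). *)
Lemma cos_doubling_le0 a : cos a != 1 -> exists e, cos (a *+ 2 ^ e) <= 0.
Proof.
move=> ca; apply: contrapT => no.
have cpos e : 0 < cos (a *+ 2 ^ e).
  by rewrite ltNge; apply/negP => h; apply: no; exists e.
have a1 : 0 < 1 - cos a by rewrite subr_gt0 lt_neqAle ca cos_le1.
have grow e : (1 - cos a) *+ 2 ^ e <= 1 - cos (a *+ 2 ^ e).
  elim: e => [|e IH]; first by rewrite expn0 !mulr1n.
  rewrite expnSr !mulrnA cos_mulr2n; have := cpos e; have := cos_le1 (a *+ 2 ^ e).
  move: ((1 - cos a) *+ 2 ^ e) (cos (a *+ 2 ^ e)) IH => y c IH c1 c0.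
  have := mulr_ge0 (ltW c0) (_ : 0 <= 1 - c); rewrite subr_ge0 => /(_ c1).
  by rewrite !mulr2n; lra.
pose e := Num.bound (1 - cos a)^-1.
have : (1 - cos a)^-1 < e%:R by apply: archi_boundP; rewrite invr_ge0 ltW.
rewrite -[X in X < _]mul1r ltr_pdivrMr // => e1.
have := grow e; have := cpos e.
have : e%:R * (1 - cos a) <= (1 - cos a) *+ 2 ^ e.
  by rewrite -[X in _ <= X]mulr_natl ler_pM2r // ler_nat ltnW // ltn_expl.
by lra.
Qed.

Lemma de_moivre a k :
  ((cos a +i* sin a) ^+ k = cos (a *+ k) +i* sin (a *+ k))%C.
Proof.
elim: k => [|k IH]; first by rewrite expr0 mulr0n cos0 sin0.
rewrite exprS IH mulrS cosD sinD; simpc.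
by congr (_ +i* _)%C; ring.
Qed.
End Trigonometry.

Section Spiralling.
Variables (R : realType) (n : nat) (M : 'M[R]_n.+1) (lambda : R[i]).
Let MC := map_mx (real_complex R) M.
Hypotheses (lNreal : lambda != lambda^*%C)
  (mul : mup lambda (char_poly MC) = 1%N)
  (mulJ : mup lambda^*%C (char_poly MC) = 1%N)
  (gap : forall mu, eigenvalue MC mu -> mu != lambda -> mu != lambda^*%C ->
    `|mu| < `|lambda|).

(** Put w = lambda^K, B = M^K and N = B^2 - 2 Re(w) B + |w|^2.  The matrix N kills
    the eigenvalues lambda and its conjugate, so B^j N x is exponentially
    smaller than |lambda|^(K j).  Since Re(w) <= 0, all three terms of B^j N x lie
    in the cone, hence in its coordinates B^j x is dominated by B^j N x / |w|^2.
    But xi grows exactly like lambda^(K j) along the orbit of x, so xi x = 0. *)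
Lemma spiralling_leaves_cone K k (V : 'M[R]_(n.+1, k)) (x : 'cV[R]_n.+1)
    (xi : 'rV[R[i]]_n.+1) :
    (0 < K)%N -> complex.Re (lambda ^+ K) <= 0 -> row_free V^T ->
    (forall y, cone_of V y -> cone_of V (M ^+ K *m y)) -> cone_of V x ->
    xi *m MC = lambda *: xi -> xi *m map_mx (real_complex R) x = 0.
Proof.
move=> K0 wle /row_free_trP[L LV] MV Vx xiM; apply: contrapT => /eqP xix.
have l0 : 0 < `|lambda|.
  rewrite normr_gt0; apply: contraNneq lNreal => ->.
  by rewrite conjc0.
have [r [r0 rl br]] : exists r : R[i], [/\ 0 < r, r < `|lambda| &
    forall g : {poly R[i]}, geom_bounded r (fun k => MC ^+ k *m
      horner_mx MC (\prod_(l <- [:: lambda; lambda^*%C]) ('X - l%:P) * g))].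
  have h1 : uniq [:: lambda; lambda^*%C] by rewrite /= inE lNreal.
  have h2 l : l \in [:: lambda; lambda^*%C] -> mup l (char_poly MC) = 1%N.
    by rewrite !inE => /orP[] /eqP->.
  have h3 mu : eigenvalue MC mu -> mu \notin [:: lambda; lambda^*%C] ->
      `|mu| < `|lambda|.
    by move=> emu; rewrite !inE negb_or => /andP[]; apply: gap.
  exact: (@spectral_gap R[i] n MC _ _ h1 l0 h2 h3).
pose w := lambda ^+ K; pose w' := lambda^*%C ^+ K.
have w'E : w^*%C = w' by rewrite /w rmorphXn.
pose b := - (complex.Re w *+ 2).
have b0 : 0 <= b by rewrite oppr_ge0 mulrn_wle0.
have wn0 : w != 0 by rewrite expf_neq0 // -normr_gt0.
pose c := complex.Re (`|w| ^+ 2).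
have cE : c%:C%C = w * w'.
  by rewrite -w'E -sqr_normc RRe_real // rpredX // normr_real.
have c0 : 0 < c by rewrite -(@ltcR R) cE -w'E -sqr_normc exprn_gt0 // normr_gt0.
pose N := M ^+ K *m M ^+ K + b *: M ^+ K + c%:M.
have [g gE] : exists g, ('X^K - w%:P) * ('X^K - w'%:P) =
    \prod_(l <- [:: lambda; lambda^*%C]) ('X - l%:P) * g.
  have dv (l : R[i]) : exists q, 'X^K - (l ^+ K)%:P = q * ('X - l%:P).
    by apply/factor_theorem; rewrite rootE !hornerE subrr.
  have [q1 q1E] := dv lambda; have [q2 q2E] := dv lambda^*%C.
  exists (q1 * q2); rewrite /w /w' q1E q2E big_cons big_seq1; ring.
have NE : map_mx (real_complex R) N =
    horner_mx MC (\prod_(l <- [:: lambda; lambda^*%C]) ('X - l%:P) * g).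
  have hX : horner_mx MC 'X^K = MC ^+ K by rewrite rmorphXn /= horner_mx_X.
  have mX : map_mx (real_complex R) (M ^+ K) = MC ^+ K by rewrite rmorphXn.
  have bE : b%:C%C = - (w + w').
    by rewrite -w'E addcJ mulr_natl rmorphN rmorphMn.
  rewrite -gE rmorphM !rmorphB /= hX !horner_mx_C.
  rewrite /N !map_mxD map_mxM map_mxZ map_scalar_mx mX /= bE cE.
  rewrite -mulmxE mulmxBl !mulmxBr mul_scalar_mx mul_mx_scalar -scalar_mxM.
  rewrite scaleNr scalerDl opprD opprB [_ - w *: _]addrC !addrA.
  by rewrite [X in X + _ = _]addrAC.
pose s j := L *m (M ^+ (K * j) *m x).
have Vj j : cone_of V (M ^+ (K * j) *m x).
  elim: j => [|j IH]; first by rewrite muln0 expr0 mul1mx.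
  by rewrite mulnS exprD -mulmxE -mulmxA; apply: MV.
have sV j : M ^+ (K * j) *m x = V *m s j.
  have [d d0 E] := Vj j; rewrite /s E (mulmxA L) LV mul1mx //.
have s0 j i : 0 <= s j i 0.
  have [d d0 E] := Vj j; rewrite /s E (mulmxA L) LV mul1mx //.
have [d dP] : geom_bounded (r ^+ K) (fun j => map_mx (real_complex R) (s j)).
  have [d dP] : geom_bounded r (fun k' => map_mx (real_complex R) L *m
     (MC ^+ k' *m map_mx (real_complex R) N *m map_mx (real_complex R) x)).
    apply/geom_bounded_mulmxl/geom_bounded_mulmxr.
    by rewrite NE; apply: br.
  exists (c%:C%C^-1 * d) => j i l; rewrite mxE normcR ord1 ger0_norm //.
  rewrite -mulrA ler_pdivlMl ?ltcR // -exprM.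
  apply: le_trans (dP (K * j)%N i 0).
  have -> : map_mx (real_complex R) L *m (MC ^+ (K * j) *m
      map_mx (real_complex R) N *m map_mx (real_complex R) x) =
      map_mx (real_complex R) (L *m (M ^+ (K * j) *m N *m x)).
    by rewrite !map_mxM rmorphXn.
  have -> : M ^+ (K * j) *m N =
      M ^+ (K * j.+2) + b *: M ^+ (K * j.+1) + c *: M ^+ (K * j).
    rewrite /N !mulmxDr -scalemxAr mul_mx_scalar !mulmxE -!exprD.
    by rewrite [(K * j + (K + K))%N]addnC -addnA [(K * j + K)%N]addnC -!mulnS.
  have mapE (Z : 'cV[R]_k) : map_mx (real_complex R) Z i 0 = (Z i 0)%:C%C.
    by rewrite mxE.
  have le3 (z2 z1 z0 : 'cV[R]_k) : 0 <= z2 i 0 -> 0 <= z1 i 0 ->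
      c * z0 i 0 <= (z2 + b *: z1 + c *: z0) i 0.
    by move=> h2 h1; rewrite !mxE lerDr addr_ge0 // mulr_ge0.
  rewrite mapE normcR -rmorphM lecR (le_trans _ (ler_norm _)) //.
  rewrite !mulmxDl -!scalemxAl !mulmxDr -!scalemxAr.
  by apply: le3; apply: s0.
have [d' d'P] : geom_bounded (r ^+ K) (fun j =>
    (xi *m map_mx (real_complex R) V) *m map_mx (real_complex R) (s j)).
  by apply: geom_bounded_mulmxl; exists d.
pose y : R[i] := (xi *m map_mx (real_complex R) x) 0 0.
have y0 : y != 0.
  by apply: contraNneq xix => y0; rewrite [_ *m _]mx11_scalar -/y y0 raddf0.
have xiP j : xi *m MC ^+ j = lambda ^+ j *: xi.
  elim: j => [|j IH]; first by rewrite !expr0 mulmx1 scale1r.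
  by rewrite exprSr -mulmxE mulmxA IH -scalemxAl xiM scalerA -exprSr.
have bound j : `|y| * `|lambda| ^+ (K * j) <= d' * r ^+ (K * j).
  have := d'P j 0 0; rewrite -mulmxA -map_mxM -sV map_mxM rmorphXn /= mulmxA.
  by rewrite xiP -scalemxAl [X in `|X| <= _ -> _]mxE -/y normrM normrX mulrC
    (exprM r).
have toR (z : R[i]) : 0 <= z -> exists q : R, z = q%:C%C.
  by move=> z0; exists (complex.Re z); rewrite RRe_real // ger0_real.
have d'0 : 0 <= d'.
  have := bound 0%N; rewrite muln0 !expr0 !mulr1; apply: le_trans.
  exact: normr_ge0.
have [yR yE] := toR _ (normr_ge0 y); have [lR lE] := toR _ (ltW l0).
have [rR rE] := toR _ (ltW r0); have [dR dE] := toR _ d'0.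
have yR0 : 0 < yR by rewrite -(@ltcR R) -yE normr_gt0.
have rR0 : 0 < rR by rewrite -(@ltcR R) -rE.
have rlR : rR < lR by rewrite -(@ltcR R) -rE -lE.
have [K1 K1P] := geometric_domination dR rR0 rlR yR0.
have := bound K1; rewrite yE lE rE dE -!rmorphXn -!rmorphM /= lecR leNgt K1P //.
by rewrite leq_pmull.
Qed.
End Spiralling.

Theorem theorem5p7 (R : realType) (n : nat) (A : 'M[int]_n) (hA : \det A != 0) :
  (forall lambda : R[i],
     (forall mu : R[i], maximal_modulus_eigenvalue A mu <-> mu = lambda) ->
     algebraic_multiplicity A lambda = 1%N ->
     lambda \is Num.real /\
     exists (Sigma : set (set 'cV[R]_n)) (k : nat),
       [/\ toric_birational_model Sigma, (0 < k)%N
         & strongly_algebraically_stable (A ^+ k) Sigma]) /\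
  (forall (lambda : R[i]) (theta : R),
     (forall mu : R[i], maximal_modulus_eigenvalue A mu <->
        mu = lambda \/ mu = lambda^*%C) ->
     algebraic_multiplicity A lambda = 1%N ->
     algebraic_multiplicity A lambda^*%C = 1%N ->
     lambda = `|lambda| * (cos (2 * pi * theta) +i* sin (2 * pi * theta))%C ->
     ~ (exists q : rat, theta = ratr q) ->
     ~ exists Sigma : set (set 'cV[R]_n),
         toric_birational_model Sigma /\ strongly_algebraically_stable A Sigma).
Proof.
split; first by move=> lambda; apply: stable_model_of_dominant_eigenvalue.
move=> lambda theta maxl mul mulJ polar irr [Sigma [model stab]].
have lmax : maximal_modulus_eigenvalue A lambda by apply/maxl; left.
have [el _] := lmax; have l0 := eigenvalue_neq0 hA el.
case: n A hA maxl mul mulJ Sigma model stab lmax el => [|n] A hA maxl mul mulJ.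
  by move=> Sigma _ _ _ /eigenvalueP[y _]; rewrite [y]thinmx0 eqxx.
move=> Sigma model stab lmax el.
pose a := 2 * pi * theta.
(* by irrationality no positive multiple of the angle is a multiple of pi *)
have sina m : (0 < m)%N -> sin (a *+ m) != 0.
  move=> m0; apply/eqP => /sin_eq0_int[z zE]; apply: irr.
  exists (z%:~R / (2 * m)%:R); rewrite fmorph_div /= ratr_int ratr_nat natrM.
  have p0 : pi != 0 :> R by rewrite gt_eqF // pi_gt0.
  apply: (mulfI p0); move: zE; rewrite /a -mulr_natr => zE.
  have m0' : m%:R != 0 :> R by rewrite pnatr_eq0 -lt0n.
  rewrite mulrA [pi * z%:~R]mulrC -zE; field.
  by rewrite m0'.
have powE m : lambda ^+ m = `|lambda| ^+ m * (cos (a *+ m) +i* sin (a *+ m))%C.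
  by rewrite {1}polar exprMn de_moivre.
have absE m : `|lambda| ^+ m = (complex.Re (`|lambda| ^+ m))%:C%C.
  by rewrite RRe_real // rpredX // normr_real.
have lNreal : lambda != lambda^*%C.
  have := sina 1%N isT; apply: contraNneq => lJ.
  have : complex.Im lambda = 0.
    by move: lJ; case: (lambda) => u v [] /esym/eqP; rewrite eqNr => /eqP.
  have [q qE] : exists q : R, `|lambda| = q%:C%C.
    by exists (complex.Re `|lambda|); rewrite RRe_real // normr_real.
  rewrite -[lambda]expr1 powE expr1 qE; move: (cos _) (sin _) => u v; simpc.
  move=> /eqP; rewrite /= mulf_eq0 => /orP[/eqP q0|//].
  by have := l0; rewrite -normr_eq0 qE q0 eqxx.
have /eigenvalueP[xi xiA xi0] := el.
have [rho xirho] := ray_off_hyperplane model xi0.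
have [s [j [m [Ss m0 sx As]]]] := stable_periodic_cone model rho stab.
have [e ce] : exists e, cos (a *+ m *+ 2 ^ e) <= 0.
  apply: cos_doubling_le0; apply: contra (sina m m0) => /eqP c1.
  by have := sin2cos2 (a *+ m); rewrite c1 expr1n subrr => /eqP; rewrite sqrf_eq0.
have [fS _ simp] := model.
have [k [tau [fV sE _ _]]] := simplicial_generators fS (simp _ Ss) Ss.
have Ake i y : s y -> s (intmx R (A ^+ (m * i)) *m y).
  elim: i => [|i IH] sy; first by rewrite muln0 expr0 map_mx1 mul1mx.
  by rewrite mulnS exprD -mulmxE map_mxM -mulmxA; apply/As/IH.
set x := intmx R (A ^+ j *m ray_generator (val rho)) in sx.
have AC : map_mx (real_complex R) (intmx R A) = intmx R[i] A.
  by rewrite intmx_complex.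
have : xi *m map_mx (real_complex R) x = 0.
  apply: (@spiralling_leaves_cone R n (intmx R A) lambda lNreal _ _ _
     (m * 2 ^ e)%N k (intmx R (generator_matrix tau))).
  - rewrite AC; exact: mul.
  - rewrite AC; exact: mulJ.
  - move=> mu; rewrite AC => emu nl nlJ.
    by apply: (nonmaximal_eigenvalue lmax emu) => /maxl[] E;
      [rewrite E eqxx in nl|rewrite E eqxx in nlJ].
  - by rewrite muln_gt0 m0 expn_gt0.
  - have [q qE] : exists q : R, `|lambda| ^+ (m * 2 ^ e) = q%:C%C by eexists.
    have q0 : 0 <= q by rewrite -(@lecR R) -qE exprn_ge0.
    rewrite powE qE mulrnA; move: (cos _) (sin _) ce => u v u0; simpc => /=.
    by rewrite mulr_ge0_le0.
  - exact: fV.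
  - by move=> y; rewrite -sE => sy; rewrite -rmorphXn; apply: Ake.
  - by rewrite -sE.
  - rewrite AC; exact: xiA.
apply/eqP.
have -> : map_mx (real_complex R) x =
    intmx R[i] A ^+ j *m intmx R[i] (ray_generator (val rho)).
  rewrite -rmorphXn /= -map_mxM; apply/matrixP => p q.
  by rewrite [in LHS]mxE [in LHS]mxE [in RHS]mxE rmorph_int.
rewrite mulmxA.
have -> : xi *m intmx R[i] A ^+ j = lambda ^+ j *: xi.
  elim: (j) => [|i IH]; first by rewrite !expr0 mulmx1 scale1r.
  by rewrite exprSr -mulmxE mulmxA IH -scalemxAl xiA scalerA -exprSr.
by rewrite -scalemxAl scaler_eq0 negb_or expf_neq0.
Qed.
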